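(* Let $\alpha,\beta,\gamma,\delta\in\mathbb{R}$, and set $\sigma(x)=\alpha x+\beta$ and $b(x)=\gamma x+\delta$ for all $x\in\mathbb{R}$. Define operators $A^*$ and $L^*$ by $$A^*\phi=-\partial(\sigma\phi),\qquad L^*\phi=\tfrac12\,\partial^2(\sigma^2\phi)-\partial(b\phi).$$ Then for every non-negative non-integer real number $p$ there is a constant $C=C(\sigma,b,p)>0$ such that $$2\langle \phi, L^*\phi\rangle_p+\|A^*\phi\|_p^2\le C\,\|\phi\|_p^2\qquad\text{for all }\phi\in\mathcal{S}(\mathbb{R}).$$
   Context: $\mathcal{S}(\mathbb{R})$ is the Schwartz space of real-valued rapidly decreasing smooth functions on $\mathbb{R}$, and $\partial$ denotes differentiation. The Hermite functions are $h_k(t)=(2^k k!\sqrt{\pi})^{-1/2}e^{-t^2/2}H_k(t)$, $k\ge 0$, where $H_k$ are the (physicists') Hermite polynomials; they form an orthonormal basis of $L^2(\mathbb{R},dx)$, whose inner product is denoted $\langle\cdot,\cdot\rangle_0$. For $p\in\mathbb{R}$ and $f,g\in\mathcal{S}(\mathbb{R})$, the Hermite-Sobolev inner product is $$\langle f,g\rangle_p=\sum_{k=0}^\infty(2k+1)^{2p}\langle f,h_k\rangle_0\langle g,h_k\rangle_0,$$ and $\|f\|_p=\langle f,f\rangle_p^{1/2}$. For $\phi\in\mathcal{S}(\mathbb{R})$, both $A^*\phi$ and $L^*\phi$ are in $\mathcal{S}(\mathbb{R})$. *)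

(* Defs.v *)
From HB Require Import structures.
From mathcomp Require Import all_boot all_order all_algebra.
From mathcomp Require Import all_classical all_reals all_analysis.
From mathcomp Require Import ring.

Set Implicit Arguments.
Unset Strict Implicit.
Unset Printing Implicit Defensive.

Import Order.TTheory GRing.Theory Num.Theory.
Import numFieldNormedType.Exports.

Local Open Scope ring_scope.
Local Open Scope classical_set_scope.

Definition schwartz (R : realType) (f : R -> R) : Prop :=
  (forall (n : nat) (x : R), derivable (derive1n n f) x 1) /\
  (forall m n : nat, exists C : R, forall x : R,
     `|x ^+ m * derive1n n f x| <= C).

(* Physicists' normalization. Differentiating Rodrigues' formula
   H_n(x) = (-1)^n e^{x^2} (d/dx)^n e^{-x^2} gives this recurrence;
   see [hermite_rodrigues]. *)
Fixpoint hermite (R : realType) (n : nat) : {poly R} :=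
  if n is m.+1 then 2%:R *: ('X * hermite R m) - deriv (hermite R m)
  else 1.

Lemma hermite_rodrigues (R : realType) (n : nat) (x : R) :
  (hermite R n).[x]
  = (-1) ^+ n * expR (x ^+ 2) * derive1n n (fun y : R => expR (- y ^+ 2)) x.
Proof.
have D m : derive1n m (fun y : R => expR (- y ^+ 2))
    = (fun y => (-1) ^+ m * (hermite R m).[y] * expR (- y ^+ 2)).
  elim: m => [|m IH].
    by rewrite derive1n0; apply/funext => y; rewrite /= hornerC expr0 !mul1r.
  rewrite derive1nS IH; apply/funext => y.
  have E : is_derive y 1 (expR \o (fun z : R => - z ^+ 2))
      (expR (- y ^+ 2) * - (2%:R * y)).
    apply: is_derive1_comp; apply: is_derive_eq.
    by rewrite /GRing.scale /=; ring.
  have P := is_deriveZ ((-1) ^+ m) (is_derive_poly (hermite R m) y).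
  have /@derive_val := is_deriveM P E.
  rewrite derive1E => H.
  transitivity ('D_1 ((-1) ^+ m \*: horner (hermite R m) * (expR \o (fun z => - z ^+ 2))) y).
    by [].
  rewrite H /= hornerD hornerN hornerZ hornerM hornerX [(-1) ^+ m.+1]exprS /GRing.scale /=.
  set w := expR _; set s := (-1) ^+ m; set u := _.[y]; set v := _.[y].
  by ring.
rewrite D; set h := _.[x]; set s := (-1) ^+ n.
have ss : s * s = 1 by rewrite /s -expr2 sqrr_sign.
have ee : expR (x ^+ 2) * expR (- x ^+ 2) = 1 by rewrite -expRD subrr expR0.
transitivity (s * s * (expR (x ^+ 2) * expR (- x ^+ 2)) * h).
  by rewrite ss ee !mul1r.
by ring.
Qed.

Definition hermite_fun (R : realType) (k : nat) (t : R) : R :=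
  (Num.sqrt (2%:R ^+ k * (k`!)%:R * Num.sqrt pi))^-1
  * expR (- (t ^+ 2 / 2%:R)) * (hermite R k).[t].

Definition ip0 (R : realType) (f g : R -> R) : R :=
  \int[lebesgue_measure]_x (f x * g x).

(* The limit of the real partial sums; they converge for Schwartz [f], [g],
   and [limn] is only meaningful in that case. *)
Definition hsip (R : realType) (p : R) (f g : R -> R) : R :=
  limn (series (fun k : nat =>
    (2 * k + 1)%:R `^ (2%:R * p)
    * ip0 f (@hermite_fun R k) * ip0 g (@hermite_fun R k))).

Definition hsnorm (R : realType) (p : R) (f : R -> R) : R :=
  Num.sqrt (hsip p f f).

Definition Astar (R : realType) (sigma phi : R -> R) : R -> R :=
  fun x => - derive1 (fun y => sigma y * phi y) x.

Definition Lstar (R : realType) (sigma b phi : R -> R) : R -> R :=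
  fun x => 2%:R^-1 * derive1n 2 (fun y => sigma y ^+ 2 * phi y) x
           - derive1 (fun y => b y * phi y) x.

(* Main.v *)
Require Import Defs.
From mathcomp Require Import all_boot all_order all_algebra.
From mathcomp Require Import all_classical all_reals all_analysis.
From mathcomp Require Import measurable_realfun.
From mathcomp Require Import ring lra zify.

Import Order.TTheory GRing.Theory Num.Theory.
Import numFieldNormedType.Exports.

(** The inequality is one about sequences of Hermite coefficients.  On them,
    multiplication by [x] and differentiation act as [(l + r) / sqrt 2] and
    [(l - r) / sqrt 2], where [l] and [r] are the lowering and raising
    operators ([hermite_coef_X], [hermite_coef_D]), and the norm of order [p]
    is the l^2 norm with weight [w k = (2 k + 1) ^ (2 p)] ([hsnorm_sqr]).

    Write [A] for [A^*].  Commuting one derivative with [sigma] gives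
    [L^* = A A / 2 - (alpha / 2) A - (b .)'] ([LstarE]), so the form to bound is
    [<c, A A c>_w + |A c|_w ^ 2] up to first-order terms.  Up to a constant, [A]
    is antisymmetric for [w = 1], and the form would then vanish up to bounded
    terms; for a general [w] it is governed by commutators of [w] with [A].
    The first commutator with [w] brings in a difference of [w], which
    gains a factor [1 / k] against the growth [k] of [A]; the second-order part
    only contains double commutators, hence second differences of [w], which
    gain [1 / k ^ 2] against the growth [k ^ 2] of [A A].

    Concretely, with [U = r - l] and [T = r r - l l], the operator [A] is
    [(alpha / 2) (T - 1) + (beta / sqrt 2) U] ([seqAE]), and the form is a
    combination of [|c|_w ^ 2] and of five elementary ones, in [U], [T], [U U],
    [T T] and [T U + U T] ([dominated_monotone]).  In each of them summation by parts
    ([dominated_adjoint]) moves every [r] to the other side as an [l],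
    which shifts the weight.  What is left is a sum of [q k * (c k * c (j + k))]
    whose coefficients [q] are combinations of first and second differences of
    [w], all bounded by a multiple of [w]; such a sum is at most a multiple of
    [|c|_w ^ 2] by [2 |x y| <= x ^ 2 + y ^ 2] ([dominated_entry]).

    All rearrangements of series are legitimate because the coefficients of a
    Schwartz function decay faster than any power of [k]
    ([rapid_hermite_coef]): they are bounded, and [x ^ 2 - d^2 / dx^2] multiplies
    them by [2 k + 1]. *)

Set Implicit Arguments.
Unset Strict Implicit.
Unset Printing Implicit Defensive.

Local Open Scope ring_scope.
Local Open Scope classical_set_scope.

(** * Rapidly decreasing sequences *)

Definition rapid (R : realType) (u : nat -> R) : Prop :=
  forall N : nat, exists C : R, forall k, `|u k| * k.+1%:R ^+ N <= C.

Definition tempered (R : realType) (u : nat -> R) : Prop :=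
  exists N : nat, exists C : R, forall k, `|u k| <= C * k.+1%:R ^+ N.

Section RapidSequences.
Context {R : realType}.
Implicit Types (u v w c : nat -> R).

Lemma ler_natS_expr (m n k : nat) : (m <= n)%N -> k.+1%:R ^+ m <= k.+1%:R ^+ n :> R.
Proof. by move=> mn; apply: ler_weXn2l => //; rewrite ler1n. Qed.

Lemma natS_gt0 k : 0 < k.+1%:R :> R. Proof. by rewrite ltr0n. Qed.

Lemma natSX_ge0 k n : 0 <= k.+1%:R ^+ n :> R.
Proof. by rewrite exprn_ge0. Qed.

Lemma rapidD u v : rapid u -> rapid v -> rapid (fun k => u k + v k).
Proof.
move=> ru rv N; have [C1 h1] := ru N; have [C2 h2] := rv N.
exists (C1 + C2) => k; apply: le_trans (lerD (h1 k) (h2 k)).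
by rewrite -mulrDl ler_wpM2r ?natSX_ge0 ?ler_normD.
Qed.

(** The power [m] lost to the growth of [v] is recovered by asking [u] for the
    decay of order [m + N]. *)
Lemma rapidM_tempered u v : tempered v -> rapid u -> rapid (fun k => v k * u k).
Proof.
move=> [m [C1 h1]] ru N; have [C2 h2] := ru (m + N)%N.
exists (`|C1| * C2) => k; rewrite normrM.
have h3 : `|v k| <= `|C1| * k.+1%:R ^+ m.
  by apply: le_trans (h1 k) _; rewrite ler_wpM2r ?natSX_ge0 ?ler_norm.
apply: (@le_trans _ _ (`|C1| * (`|u k| * k.+1%:R ^+ (m + N)))).
  rewrite exprD.
  have -> : `|C1| * (`|u k| * (k.+1%:R ^+ m * k.+1%:R ^+ N)) =
     (`|C1| * k.+1%:R ^+ m) * (`|u k| * k.+1%:R ^+ N) by ring.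
  by rewrite -[leLHS]mulrA ler_wpM2r ?mulr_ge0 ?natSX_ge0.
by rewrite ler_wpM2l.
Qed.

Lemma tempered_rapid u : rapid u -> tempered u.
Proof. by move=> /(_ 0%N)[C h]; exists 0%N, C => k; have := h k; rewrite !expr0 !mulr1. Qed.

Lemma tempered_cst (a : R) : tempered (fun=> a).
Proof. by exists 0%N, `|a| => k; rewrite expr0 mulr1. Qed.

Lemma temperedM u v : tempered u -> tempered v -> tempered (fun k => u k * v k).
Proof.
move=> [m [C h]] [n [D g]]; exists (m + n)%N, (C * D) => k; rewrite normrM exprD.
by rewrite mulrACA; apply: ler_pM.
Qed.

Lemma rapidZ (a : R) u : rapid u -> rapid (fun k => a * u k).
Proof. by move=> ru; apply: rapidM_tempered => //; exact: tempered_cst. Qed.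

Lemma rapidB u v : rapid u -> rapid v -> rapid (fun k => u k - v k).
Proof.
move=> ru rv; have := rapidD ru (rapidZ (-1) rv).
by under [X in rapid X -> _]eq_fun do rewrite mulN1r.
Qed.

Lemma rapidM u v : rapid u -> rapid v -> rapid (fun k => u k * v k).
Proof. by move=> /tempered_rapid tu; exact: rapidM_tempered. Qed.

Lemma rapid_succ u : rapid u -> rapid (fun k => u k.+1).
Proof.
move=> ru N; have [C h] := ru N; exists C => k; apply: le_trans (h k.+1).
by rewrite ler_wpM2l// lerXn2r ?nnegrE// ler_nat.
Qed.

Lemma natS_le_2pred k : k.+1%:R <= 2 * k.-1.+1%:R :> R.
Proof.
by case: k => [|k] /=; [rewrite mulr1 ler1n|rewrite -natrM ler_nat mul2n -addnn addSn addnS !ltnS leq_addl].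
Qed.

Lemma rapid_pred u : rapid u -> rapid (fun k => u k.-1).
Proof.
move=> ru N; have [C h] := ru N; exists (2 ^+ N * C) => k.
apply: (@le_trans _ _ (2 ^+ N * (`|u k.-1| * k.-1.+1%:R ^+ N))).
  rewrite mulrCA ler_wpM2l// -exprMn lerXn2r ?nnegrE ?mulr_ge0//.
  exact: natS_le_2pred.
by rewrite ler_wpM2l ?exprn_ge0.
Qed.

Lemma tempered_succ u : tempered u -> tempered (fun k => u k.+1).
Proof.
move=> [N [C h]]; exists N, (`|C| * 2 ^+ N) => k.
apply: le_trans (h k.+1) _.
apply: (@le_trans _ _ (`|C| * k.+2%:R ^+ N)); first by rewrite ler_wpM2r ?ler_norm ?exprn_ge0.
by rewrite -mulrA ler_wpM2l// -exprMn lerXn2r ?nnegrE ?mulr_ge0// (natS_le_2pred k.+1).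
Qed.

Lemma tempered_pred u : tempered u -> tempered (fun k => u k.-1).
Proof.
move=> [N [C h]]; exists N, `|C| => k; apply: le_trans (h k.-1) _.
apply: (@le_trans _ _ (`|C| * k.-1.+1%:R ^+ N)).
  by rewrite ler_wpM2r ?ler_norm ?exprn_ge0.
by rewrite ler_wpM2l// lerXn2r ?nnegrE// ler_nat ltnS leq_pred.
Qed.

Lemma tempered_nat : tempered (fun k => k%:R : R).
Proof. by exists 1%N, 1 => k; rewrite expr1 mul1r ger0_norm ?ler_nat. Qed.

Lemma ler_sqrt_nat k : Num.sqrt k%:R <= k%:R :> R.
Proof.
case: k => [|k]; first by rewrite sqrtr0.
by rewrite -[leRHS]ger0_norm// -sqrtr_sqr ler_wsqrtr// expr2 -natrM ler_nat leq_pmulr.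
Qed.

End RapidSequences.

Section RapidSeries.
Context {R : realType}.
Implicit Types (u v w c f g : nat -> R).

Lemma rapid_cvg0 f : rapid f -> f @ \oo --> 0.
Proof.
move=> /(_ 1%N)[C h].
have hC k : `|f k| <= C * harmonic k.
  by rewrite /harmonic ler_pdivlMr ?natS_gt0//; have := h k; rewrite expr1.
apply/norm_cvg0P; apply: (@squeeze_cvgr _ _ _ _ (cst 0) (fun k => C * harmonic k)).
- by apply: nearW => k; rewrite normr_ge0 hC.
- exact: cvg_cst.
- by rewrite -[X in _ --> X](mulr0 C); apply: cvgMl_tmp; exact: cvg_harmonic.
Qed.

(** Comparison with the telescoping series of general term
    [2 / ((k + 1) (k + 2))], which dominates [1 / (k + 1) ^ 2]. *)
Lemma rapid_summable f : rapid f -> cvgn (series f).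
Proof.
move=> /(_ 2%N)[C h]; apply: normed_cvg; apply: nondecreasing_is_cvgn.
  apply: (@nondecreasing_series _ (fun k => `|f k|) xpredT 0) => n _ _ /=.
  exact: normr_ge0.
exists (2 * C) => _ [n _ <-].
have C0 : 0 <= C by apply: le_trans (h 0%N); rewrite mulr_ge0 ?natSX_ge0.
suff : series (fun k => `|f k|) n <= 2 * C - 2 * C / n.+1%:R.
  by move/le_trans; apply; rewrite gerBl divr_ge0 ?mulr_ge0.
elim: n => [|n ih]; first by rewrite /series /= big_geq// divr1 subrr.
rewrite seriesSr; apply: le_trans (lerD ih (lexx _)) _.
have h1 : `|f n| <= C / n.+1%:R ^+ 2 by rewrite ler_pdivlMr ?exprn_gt0 ?natS_gt0 ?h.
have h2 : C / n.+1%:R ^+ 2 <= 2 * C / n.+1%:R - 2 * C / n.+2%:R.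
  have -> : 2 * C / n.+1%:R - 2 * C / n.+2%:R = C * (2 / (n.+1%:R * n.+2%:R)).
    rewrite -[n.+2%:R]natr1; have := natS_gt0 (R := R) n; set x := n.+1%:R => x0.
    by field; rewrite !lt0r_neq0// addr_gt0.
  rewrite ler_wpM2l// ler_pdivlMr ?mulr_gt0 ?natS_gt0// mulrC expr2 ler_pdivrMr ?mulr_gt0 ?natS_gt0//.
  by rewrite mulrCA ler_wpM2l// (natS_le_2pred n.+1).
move: (le_trans h1 h2); move: (2 * C / n.+1%:R) (2 * C / n.+2%:R) => x y; lra.
Qed.

Lemma series_sumD f g : rapid f -> rapid g ->
  limn (series (fun k => f k + g k)) = limn (series f) + limn (series g).
Proof. by move=> /rapid_summable cf /rapid_summable cg; rewrite -lim_seriesD. Qed.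

Lemma series_sumZ (a : R) f : rapid f ->
  limn (series (fun k => a * f k)) = a * limn (series f).
Proof. by move=> /rapid_summable cf; rewrite -[RHS]/(a *: _) -lim_seriesZ. Qed.

Lemma series_sum_le f g : rapid f -> rapid g -> (forall k, f k <= g k) ->
  limn (series f) <= limn (series g).
Proof.
move=> /rapid_summable cf /rapid_summable cg fg.
by apply: lim_series_le.
Qed.

Lemma series_sum_norm_le f : rapid f ->
  `|limn (series f)| <= limn (series (fun k => `|f k|)).
Proof.
move=> rf; apply: lim_series_norm; apply: rapid_summable => N.
by have [C h] := rf N; exists C => k; rewrite normr_id.
Qed.

Lemma series_sum_ge0 f : rapid f -> (forall k, 0 <= f k) -> 0 <= limn (series f).
Proof.
move=> rf f0; apply: limr_ge; first exact: rapid_summable.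
by apply: nearW => n; apply: sumr_ge0.
Qed.

Lemma series_sum_telescope f : rapid f -> f 0%N = 0 ->
  limn (series (fun k => f k - f k.+1)) = 0.
Proof.
move=> rf f0; apply: cvg_lim => //.
have -> : series (fun k => f k - f k.+1) = (fun n => - f n).
  apply/funext => n; rewrite /series /=.
  elim: n => [|n ih]; first by rewrite big_geq// f0 oppr0.
  by rewrite big_nat_recr//= ih; ring.
by rewrite -oppr0; apply: cvgN; exact: rapid_cvg0.
Qed.

Lemma series_sum_succ f : rapid f ->
  limn (series (fun k => f k.+1)) = limn (series f) - f 0%N.
Proof.
move=> rf; apply: cvg_lim => //.
have -> : series (fun k => f k.+1) = (fun n => series f n.+1 - f 0%N).
  by apply/funext => n; rewrite /series /= big_nat_recl//= addrC addKr.
apply: cvgB; last exact: cvg_cst.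
by rewrite (cvg_shiftS (series f)); exact: rapid_summable.
Qed.

End RapidSeries.

(** * Ladder operators and dominated quadratic functionals *)

Definition lower (R : realType) (c : nat -> R) (k : nat) : R :=
  Num.sqrt k.+1%:R * c k.+1.

Definition raise (R : realType) (c : nat -> R) (k : nat) : R :=
  Num.sqrt k%:R * c k.-1.

Definition energy (R : realType) (w c : nat -> R) : R :=
  limn (series (fun k => w k * c k ^+ 2)).

(** [F] stands for a quadratic functional of [c], given by its terms; only the
    sum of the terms is compared with the energy, so that telescoping terms
    count for nothing. *)
Definition dominated (R : realType) (w : nat -> R)
    (F : (nat -> R) -> nat -> R) : Prop :=
  exists C : R, forall c, rapid c ->
    rapid (F c) /\ `|limn (series (F c))| <= C * energy w c.

(** The analogue, relative to [w], of pseudo-differential symbols: [q] is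
    smaller than [w] by the factor [k ^ n]. *)
Definition symbol_of_order (R : realType) (w : nat -> R) (n : nat) (q : nat -> R) :=
  exists C : R, forall k, `|q k| * k.+1%:R ^+ n <= C * w k.

(** The two difference estimates say that [w] varies like a power of [k], to
    the order at which the double commutators stop. *)
Definition tame_weight (R : realType) (w : nat -> R) : Prop :=
  [/\ forall k, 0 < w k, forall k, w k <= w k.+1, tempered w,
      symbol_of_order w 1 (fun k => w k.+1 - w k) &
      symbol_of_order w 2 (fun k => w k.+2 - 2 * w k.+1 + w k)].

Section Ladder.
Context {R : realType}.
Implicit Types (u v w c f g : nat -> R).

Lemma tempered_sqrt : tempered (fun k => Num.sqrt k%:R : R).
Proof.
exists 1%N, 1 => k; rewrite expr1 mul1r ger0_norm ?sqrtr_ge0//.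
by rewrite (le_trans (ler_sqrt_nat _))// ler_nat.
Qed.

Lemma rapid_lower c : rapid c -> rapid (lower c).
Proof.
move=> rc; apply: (@rapidM_tempered _ (fun k => c k.+1)); last exact: rapid_succ.
exact: (tempered_succ tempered_sqrt).
Qed.

Lemma rapid_raise c : rapid c -> rapid (raise c).
Proof.
move=> rc; apply: (@rapidM_tempered _ (fun k => c k.-1)); last exact: rapid_pred.
exact: tempered_sqrt.
Qed.

Lemma raiseS c k : raise c k.+1 = Num.sqrt k.+1%:R * c k.
Proof. by []. Qed.

Lemma raise0 c : raise c 0 = 0.
Proof. by rewrite /raise sqrtr0 mul0r. Qed.

Lemma sqr_sqrt_nat k : Num.sqrt k%:R * Num.sqrt k%:R = k%:R :> R.
Proof. by rewrite -expr2 sqr_sqrtr. Qed.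

Lemma lower_raise c k : lower (raise c) k = k.+1%:R * c k.
Proof. by rewrite /lower raiseS mulrA sqr_sqrt_nat. Qed.

Lemma raise_lower c k : raise (lower c) k = k%:R * c k.
Proof.
case: k => [|k]; first by rewrite raise0 mul0r.
by rewrite raiseS /lower mulrA sqr_sqrt_nat.
Qed.

Lemma eq_raise f g : f =1 g -> raise f =1 raise g.
Proof. by move=> fg k; rewrite /raise fg. Qed.

Lemma eq_lower f g : f =1 g -> lower f =1 lower g.
Proof. by move=> fg k; rewrite /lower fg. Qed.

(** ** Closure properties of domination *)

Lemma eq_dominated w F G :
  (forall c k, F c k = G c k) -> dominated w G -> dominated w F.
Proof.
move=> FG; suff -> : F = G by [].
by apply/funext => c; apply/funext => k; exact: FG.
Qed.

Lemma dominatedD w F G : dominated w F -> dominated w G ->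
  dominated w (fun c k => F c k + G c k).
Proof.
move=> [C hC] [D hD]; exists (C + D) => c rc.
have [rF lF] := hC c rc; have [rG lG] := hD c rc; split; first exact: rapidD.
by rewrite series_sumD// mulrDl (le_trans (ler_normD _ _))// lerD.
Qed.

Lemma dominatedZ w (a : R) F : dominated w F -> dominated w (fun c k => a * F c k).
Proof.
move=> [C hC]; exists (`|a| * C) => c rc.
have [rF lF] := hC c rc; split; first exact: rapidZ.
by rewrite series_sumZ// normrM -mulrA ler_wpM2l.
Qed.

Lemma dominated_telescope w (J : (nat -> R) -> nat -> R) :
  (forall c, rapid c -> rapid (J c)) -> (forall c, J c 0%N = 0) ->
  dominated w (fun c k => J c k - J c k.+1).
Proof.
move=> rJ J0; exists 0 => c rc; split.
  by apply: rapidB; [exact: rJ|apply: rapid_succ; exact: rJ].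
by rewrite (series_sum_telescope (rJ _ rc) (J0 c)) normr0 mul0r.
Qed.

(** Summation by parts: [raise] moves across the pairing of weight [v] as
    [lower], and the weight is shifted.  The boundary term at [0] vanishes with
    the factor [Num.sqrt 0] in [raise]. *)
Lemma dominated_adjoint w v (P Q : (nat -> R) -> nat -> R) :
  tempered v -> (forall c, rapid c -> rapid (P c)) ->
  (forall c, rapid c -> rapid (Q c)) ->
  dominated w (fun c k => v k * P c k * raise (Q c) k
                          - v k.+1 * lower (P c) k * Q c k).
Proof.
move=> tv rP rQ.
apply: (@eq_dominated w _ (fun c k => (v k * (P c k * raise (Q c) k))
    - (v k.+1 * (P c k.+1 * raise (Q c) k.+1)))).
  by move=> c k; rewrite raiseS /lower; ring.
apply: (@dominated_telescope _ (fun c k => v k * (P c k * raise (Q c) k))).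
- move=> c rc; apply: rapidM_tempered => //; apply: rapidM; first exact: rP.
  by apply: rapid_raise; exact: rQ.
- by move=> c; rewrite raise0 !mulr0.
Qed.

End Ladder.

Section TameWeight.
Context {R : realType} (w : nat -> R) (tw : tame_weight w).
Implicit Types (q : nat -> R).

Let w_gt0 k : 0 < w k. Proof. by case: tw. Qed.
Let w_ge0 k : 0 <= w k. Proof. exact: ltW. Qed.
Let w_le k : w k <= w k.+1. Proof. by case: tw. Qed.
Let w_tempered : tempered w. Proof. by case: tw. Qed.

Lemma symbol_of_order_ge0 n q : symbol_of_order w n q ->
  exists2 C, 0 <= C & forall k, `|q k| * k.+1%:R ^+ n <= C * w k.
Proof.
move=> [C h]; exists `|C| => // k; apply: le_trans (h k) _.
by rewrite ler_wpM2r ?ler_norm.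
Qed.

Lemma eq_symbol n q q' : q =1 q' -> symbol_of_order w n q -> symbol_of_order w n q'.
Proof. by move=> qq' [C h]; exists C => k; rewrite -qq'. Qed.

Lemma symbolD n q q' : symbol_of_order w n q -> symbol_of_order w n q' ->
  symbol_of_order w n (fun k => q k + q' k).
Proof.
move=> [C h] [D g]; exists (C + D) => k.
rewrite mulrDl; apply: le_trans (lerD (h k) (g k)).
by rewrite -mulrDl ler_wpM2r ?natSX_ge0 ?ler_normD.
Qed.

(** A factor of growth [k ^ m] costs [m] orders. *)
Lemma symbolM m n (v q : nat -> R) (B : R) : (forall k, `|v k| <= B * k.+1%:R ^+ m) ->
  symbol_of_order w (m + n) q -> symbol_of_order w n (fun k => v k * q k).
Proof.
move=> hv [C h]; exists (B * C) => k; rewrite normrM.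
have B0 : 0 <= B.
  by have := le_trans (normr_ge0 _) (hv 0%N); rewrite expr1n mulr1.
apply: (@le_trans _ _ (B * (`|q k| * k.+1%:R ^+ (m + n)))).
  rewrite exprD.
  have -> : B * (`|q k| * (k.+1%:R ^+ m * k.+1%:R ^+ n)) =
     (B * k.+1%:R ^+ m) * (`|q k| * k.+1%:R ^+ n) by ring.
  by rewrite -[leLHS]mulrA; apply: ler_wpM2r => //; rewrite mulr_ge0.
by rewrite -[leRHS]mulrA ler_wpM2l.
Qed.

Lemma symbolZ n (a : R) q : symbol_of_order w n q ->
  symbol_of_order w n (fun k => a * q k).
Proof. by apply: (@symbolM 0 n _ _ `|a|) => k; rewrite expr0 mulr1. Qed.

Lemma symbol_weight : symbol_of_order w 0 w.
Proof. by exists 1 => k; rewrite expr0 mulr1 mul1r ger0_norm. Qed.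

Lemma symbol_diff1 : symbol_of_order w 1 (fun k => w k.+1 - w k).
Proof. by case: tw. Qed.

Lemma symbol_diff2 : symbol_of_order w 2 (fun k => w k.+2 - 2 * w k.+1 + w k).
Proof. by case: tw. Qed.

Lemma weight_succ_le : exists2 C, 0 <= C & forall k, w k.+1 <= C * w k.
Proof.
have [C C0 h] := symbol_of_order_ge0 symbol_diff1.
exists (C + 1) => [|k]; first by rewrite addr_ge0.
rewrite mulrDl mul1r -lerBlDr; apply: le_trans (h k).
rewrite expr1 (le_trans (ler_norm _))// ler_peMr//.
by rewrite ler1n.
Qed.

Lemma symbol_succ n q : symbol_of_order w n q ->
  symbol_of_order w n (fun k => q k.+1).
Proof.
move=> /symbol_of_order_ge0[C C0 h]; have [D D0 g] := weight_succ_le.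
exists (C * D) => k; apply: (@le_trans _ _ (`|q k.+1| * k.+2%:R ^+ n)).
  by rewrite ler_wpM2l// lerXn2r ?nnegrE// ler_nat.
by apply: le_trans (h k.+1) _; rewrite -mulrA ler_wpM2l.
Qed.

(** Estimates on combinations involving [w k.-1] can be checked at [k.+1],
    where the predecessor computes; the missing value at [0] only affects the
    constant because [w 0] is positive. *)
Lemma symbol_of_succ n q : symbol_of_order w n (fun k => q k.+1) ->
  symbol_of_order w n q.
Proof.
move=> /symbol_of_order_ge0[C C0 h].
exists (2 ^+ n * C + `|q 0%N| / w 0%N) => k.
rewrite mulrDl; case: k => [|k].
  by rewrite expr1n mulr1 divfK ?gt_eqF// ler_wpDl// !mulr_ge0 ?exprn_ge0.
rewrite ler_wpDr//; first by rewrite mulr_ge0// divr_ge0.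
apply: (@le_trans _ _ (2 ^+ n * (`|q k.+1| * k.+1%:R ^+ n))).
  rewrite mulrCA ler_wpM2l// -exprMn lerXn2r ?nnegrE ?mulr_ge0//.
  exact: (natS_le_2pred k.+1).
by rewrite -mulrA ler_wpM2l ?exprn_ge0// (le_trans (h k))// ler_wpM2l.
Qed.

Lemma weight_le_add j k : w k <= w (j + k)%N.
Proof. by elim: j => [|j ih] //; rewrite addSn (le_trans ih). Qed.

Lemma rapid_weighted c : rapid c -> rapid (fun k => w k * c k ^+ 2).
Proof. by move=> rc; apply: rapidM_tempered => //; exact: rapidM. Qed.

Lemma energy_ge0 c : rapid c -> 0 <= energy w c.
Proof.
move=> rc; apply: series_sum_ge0; first exact: rapid_weighted.
by move=> k; rewrite mulr_ge0 ?sqr_ge0.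
Qed.

Lemma tempered_symbol q : symbol_of_order w 0 q -> tempered q.
Proof.
move=> /symbol_of_order_ge0[C C0 h]; have [N [D g]] := w_tempered.
exists N, (C * D) => k; have := h k; rewrite expr0 mulr1 => /le_trans; apply.
by rewrite -mulrA ler_wpM2l// (le_trans _ (g k))// ler_norm.
Qed.

(** The off-diagonal product is absorbed by [2 |x y| <= x ^ 2 + y ^ 2]; as [w]
    is nondecreasing, [w k] may be replaced by [w (j + k)] in front of
    [c (j + k) ^ 2]. *)
Lemma dominated_entry (j : nat) q : symbol_of_order w 0 q ->
  dominated w (fun c k => q k * (c k * c (j + k)%N)).
Proof.
move=> sq; have /symbol_of_order_ge0[C C0 h] := sq.
exists C => c rc.
have rj i : rapid (fun k => c (i + k)%N).
  elim: i => [|i ih]; first by [].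
  by have := rapid_succ ih; under eq_fun do rewrite addnS.
have rF : rapid (fun k => q k * (c k * c (j + k)%N)).
  by apply: rapidM_tempered; [exact: tempered_symbol|exact: rapidM].
split => //; apply: le_trans (series_sum_norm_le rF) _.
pose g k := w k * c k ^+ 2.
have rg : rapid g by exact: rapid_weighted.
have rgj i : rapid (fun k => g (i + k)%N).
  elim: i => [|i ih]; first by [].
  by have := rapid_succ ih; under eq_fun do rewrite addnS.
have g0 k : 0 <= g k by rewrite mulr_ge0 ?sqr_ge0.
have lgj i : limn (series (fun k => g (i + k)%N)) <= limn (series g).
  elim: i => [|i ih]; first by [].
  under eq_fun do rewrite addSn -addnS.
  by rewrite (series_sum_succ (rgj i)) (le_trans _ ih)// gerBl.
apply: (@le_trans _ _ (limn (series (fun k => C / 2 * (g k + g (j + k)%N))))).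
  apply: series_sum_le.
  - move=> N; have [B hB] := rF N; exists B => k; by rewrite normr_id.
  - by apply: rapidZ; apply: rapidD.
  move=> k; rewrite normrM.
  have := h k; rewrite expr0 mulr1 => hk.
  apply: le_trans (ler_wpM2r (normr_ge0 _) hk) _.
  rewrite -!mulrA ler_wpM2l//.
  apply: (@le_trans _ _ (w k * (2^-1 * (c k ^+ 2 + c (j + k)%N ^+ 2)))).
    rewrite ler_wpM2l// normrM.
    rewrite -[c k ^+ 2]real_normK ?num_real// -[c (j + k)%N ^+ 2]real_normK ?num_real//.
    have := sqr_ge0 (`|c k| - `|c (j + k)%N|); rewrite sqrrB; lra.
  rewrite mulrCA ler_wpM2l// /g mulrDr lerD// ler_wpM2r ?sqr_ge0//.
  exact: weight_le_add.
rewrite series_sumZ; last exact: rapidD.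
rewrite series_sumD//.
rewrite -[leRHS]/(C * limn (series g)) -mulrA ler_wpM2l//.
have := lgj j; lra.
Qed.

End TameWeight.

Section MainForms.
Context {R : realType} (w : nat -> R) (tw : tame_weight w).

Let w_tempered : tempered w. Proof. by case: tw. Qed.

(** Square roots are estimated in pairs: a product of two of them grows like
    [k], whereas [sqrt_growth] loses half an order on each. *)
Lemma sqrtM_growth (i j k : nat) :
  `|Num.sqrt (i + k)%:R * Num.sqrt (j + k)%:R| <= (i + j).+2%:R * k.+1%:R ^+ 1 :> R.
Proof.
rewrite ger0_norm ?mulr_ge0 ?sqrtr_ge0// expr1.
have h m : Num.sqrt (m + k)%:R * Num.sqrt (m + k)%:R <= m.+1%:R * k.+1%:R :> R.
  by rewrite sqr_sqrt_nat -natrM ler_nat mulSn mulnS addSn; lia.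
have -> : (i + j).+2%:R = i.+1%:R + j.+1%:R :> R by rewrite -natrD addSn addnS.
have := sqr_ge0 (Num.sqrt (i + k)%:R - Num.sqrt (j + k)%:R : R).
have := h i; have := h j; rewrite sqrrB !expr2 mulrDl.
have : 0 <= Num.sqrt (i + k)%:R * Num.sqrt (j + k)%:R :> R by rewrite mulr_ge0 ?sqrtr_ge0.
by lra.
Qed.

Lemma sqrt_growth (i k : nat) :
  `|Num.sqrt (i + k)%:R| <= i.+1%:R * k.+1%:R ^+ 1 :> R.
Proof.
rewrite ger0_norm ?sqrtr_ge0// expr1; apply: le_trans (ler_sqrt_nat _) _.
by rewrite -natrM ler_nat mulSn mulnS addSn; lia.
Qed.

Lemma nat_growth (i k : nat) : `|(i + k)%:R| <= i.+1%:R * k.+1%:R ^+ 1 :> R.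
Proof. by rewrite ger0_norm// expr1 -natrM ler_nat mulSn mulnS addSn; lia. Qed.

Lemma symbolW (m n : nat) (q : nat -> R) :
  symbol_of_order w (m + n) q -> symbol_of_order w n q.
Proof.
move=> [C h]; exists C => k; apply: le_trans (h k).
by rewrite ler_wpM2l// ler_natS_expr// leq_addl.
Qed.

(** ** Forms of first order in U and T *)

Lemma dominated_weight : dominated w (fun c k => w k * (c k * c k)).
Proof. exact: (dominated_entry tw 0 (symbol_weight tw)). Qed.

(** After moving [raise] to the left, the coefficient of [c k * c k.+1] is
    [Num.sqrt k.+1%:R] times a first difference of [w]. *)
Lemma dominated_form_U :
  dominated w (fun c k => w k * (c k * (raise c k - lower c k))).
Proof.
have H1 := @dominated_adjoint R w w id id w_tempered (fun c rc => rc) (fun c rc => rc).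
have sq : symbol_of_order w 0 (fun k => Num.sqrt k.+1%:R * (w k.+1 - w k)).
  exact: (@symbolM _ w 1 0 _ _ _ (sqrt_growth 1) (symbol_diff1 tw)).
have H := dominatedD H1 (dominated_entry tw 1 sq).
by apply: eq_dominated H => c k /=; rewrite /lower; ring.
Qed.

Lemma tempered_natM (i : nat) (v : nat -> R) : tempered v ->
  tempered (fun k => (i + k)%:R * v k).
Proof.
move=> tv; apply: temperedM => //; exists 1%N, i.+1%:R => k; exact: nat_growth.
Qed.

Lemma symbol_diff_two : symbol_of_order w 1 (fun k => w k.+2 - w k).
Proof.
apply: eq_symbol (symbolD (symbol_succ tw (symbol_diff1 tw)) (symbol_diff1 tw)).
by move=> k /=; ring.
Qed.

Lemma dominated_form_T : dominated w
  (fun c k => w k * (c k * (raise (raise c) k - lower (lower c) k))).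
Proof.
have idr (c : nat -> R) : rapid c -> rapid c by [].
have w1 := tempered_succ w_tempered.
have H1 := dominated_adjoint w w_tempered idr (@rapid_raise R).
have H2 := dominated_adjoint w w1 (@rapid_lower R) idr.
have sq := symbolM (sqrtM_growth 1 2) symbol_diff_two.
have H := dominatedD (dominatedD H1 H2) (dominated_entry tw 2 sq).
by apply: eq_dominated H => c k /=; rewrite /lower; ring.
Qed.

(** ** Forms of second order in U and T *)

(** The form [<c, U U c>_w + |U c|_w ^ 2], with [U U c] expanded: the
    coefficient of [c k * c k.+2] is a second difference of [w], and the diagonal
    one a combination of first differences. *)
Lemma dominated_form_UU : dominated w (fun c k =>
  w k * (c k * (raise (raise c) k - (2 * k%:R + 1) * c k + lower (lower c) k)
         + (raise c k - lower c k) ^+ 2)).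
Proof.
have idr (c : nat -> R) : rapid c -> rapid c by [].
have w1 := tempered_succ w_tempered.
have wm := tempered_pred w_tempered.
have H1 := dominated_adjoint w w_tempered idr (@rapid_raise R).
have H2 := dominated_adjoint w w1 (@rapid_lower R) idr.
have H3 := dominated_adjoint w w_tempered (@rapid_raise R) idr.
have H4 := dominated_adjoint w w_tempered (@rapid_lower R) idr.
have H5 := dominated_adjoint w wm idr (@rapid_lower R).
have E2 := symbolM (sqrtM_growth 1 2) (symbolW (m := 1) (n := 1) (symbol_diff2 tw)).
have E0 : symbol_of_order w 0 (fun k =>
    k.+1%:R * w k.+1 - (2 * k%:R + 1) * w k + k%:R * w k.-1).
  apply: (symbol_of_succ tw).
  have S2 := symbolM (nat_growth 1) (symbolW (m := 1) (n := 1) (symbol_diff2 tw)).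
  have S1 := symbolW (m := 1) (n := 0) (symbol_succ tw (symbol_diff1 tw)).
  by apply: eq_symbol (symbolD S2 S1) => k /=; rewrite add1n -!natr1; ring.
have H := dominatedD H1 (dominatedD H2 (dominatedD H3 (dominatedD (dominatedZ (- 2) H4)
  (dominatedD (dominatedZ (- 1) H5) (dominatedD (dominated_entry tw 2 E2)
    (dominated_entry tw 0 E0)))))).
apply: eq_dominated H => c k /=.
rewrite raise_lower lower_raise /lower -!natr1; ring.
Qed.

(** The form [<c, T T c>_w + |T c|_w ^ 2], with [T T c] expanded.  The growth of
    order [k ^ 2] leaves no slack: on the diagonal the first differences over two
    steps, [w k.+2 - w k] and [w k - w k.-2], come with coefficients close to
    [k ^ 2] and opposite signs, and only their difference is small enough. *)
Lemma dominated_form_TT : dominated w (fun c k =>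
  w k * (c k * (raise (raise (raise (raise c))) k
                - (2 * k%:R ^+ 2 + 2 * k%:R + 2) * c k
                + lower (lower (lower (lower c))) k)
         + (raise (raise c) k - lower (lower c) k) ^+ 2)).
Proof.
have idr (c : nat -> R) : rapid c -> rapid c by [].
have rr (c : nat -> R) (rc : rapid c) := rapid_raise (rapid_raise rc).
have rrr (c : nat -> R) (rc : rapid c) := rapid_raise (rr _ rc).
have ll (c : nat -> R) (rc : rapid c) := rapid_lower (rapid_lower rc).
have lll (c : nat -> R) (rc : rapid c) := rapid_lower (ll _ rc).
have w1 := tempered_succ w_tempered.
have w2 := tempered_succ w1.
have w3 := tempered_succ w2.
have wm := tempered_pred w_tempered.
have wmm := tempered_pred (temperedM (tempered_nat) wm).
have H1 := dominated_adjoint w w_tempered idr rrr.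
have H2 := dominated_adjoint w w1 (@rapid_lower R) rr.
have H3 := dominated_adjoint w w2 ll (@rapid_raise R).
have H4 := dominated_adjoint w w3 lll idr.
have H5 := dominated_adjoint w w_tempered rr (@rapid_raise R).
have H6 := dominated_adjoint w (tempered_natM 1 w1) (@rapid_raise R) idr.
have H7 := dominated_adjoint w w_tempered ll (@rapid_raise R).
have H8 := dominated_adjoint w w1 lll idr.
have H9 := dominated_adjoint w wm (@rapid_lower R) ll.
have H10 := dominated_adjoint w wmm idr (@rapid_lower R).
have D2 := symbol_diff2 tw; have D1 := symbol_diff1 tw.
have S4 : symbol_of_order w 2 (fun k => w k.+4 - 2 * w k.+2 + w k).
  apply: eq_symbol (symbolD (symbolD D2 (symbolZ 2 (symbol_succ tw D2)))
    (symbol_succ tw (symbol_succ tw D2))) => k /=; ring.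
have E4 := symbolM (sqrtM_growth 1 2) (symbolM (sqrtM_growth 3 4) S4).
have E0 : symbol_of_order w 0 (fun k =>
    k.+2%:R * k.+1%:R * w k.+2 - (2 * k%:R ^+ 2 + 2 * k%:R + 2) * w k
    + k%:R * (k.-1%:R * w k.-1.-1)).
  apply: (symbol_of_succ tw); apply: (symbol_of_succ tw).
  have S2 := symbolM (nat_growth 1) (symbolM (nat_growth 2) S4).
  have S1 := symbol_succ tw (symbol_succ tw symbol_diff_two).
  have S1' := symbolM (nat_growth 0) (symbolZ 4 S1).
  have S1'' := symbolW (m := 1) (n := 0) (symbolZ 10 S1).
  apply: eq_symbol (symbolD S2 (symbolD S1' S1'')) => k /=.
  by rewrite add0n add1n add2n -!natr1; ring.
have H := dominatedD (dominatedD (dominatedD H1 H2) (dominatedD H3 H4))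
  (dominatedD (dominatedD (dominatedD H5 H6)
    (dominatedD (dominatedZ (- 2) H7) (dominatedZ (- 2) H8)))
  (dominatedD (dominatedD (dominatedZ (- 1) H9) (dominatedZ (- 1) H10))
    (dominatedD (dominated_entry tw 4 E4) (dominated_entry tw 0 E0)))).
apply: eq_dominated H => c k /=.
by rewrite !raise_lower !lower_raise /lower !add0n !add1n !add2n -!natr1; ring.
Qed.

(** The polarization of the two previous forms,
    [<c, (T U + U T) c>_w + 2 <T c, U c>_w], with [(T U + U T) c] expanded. *)
Lemma dominated_form_TU : dominated w (fun c k =>
  w k * (c k * (2 * raise (raise (raise c)) k - 2 * k%:R * raise c k
                - (2 * k%:R + 2) * lower c k + 2 * lower (lower (lower c)) k)
         + 2 * (raise (raise c) k - lower (lower c) k)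
             * (raise c k - lower c k))).
Proof.
have idr (c : nat -> R) : rapid c -> rapid c by [].
have rr (c : nat -> R) (rc : rapid c) := rapid_raise (rapid_raise rc).
have ll (c : nat -> R) (rc : rapid c) := rapid_lower (rapid_lower rc).
have w1 := tempered_succ w_tempered.
have w2 := tempered_succ w1.
have wm := tempered_pred w_tempered.
have H1 := dominated_adjoint w w_tempered idr rr.
have H2 := dominated_adjoint w w1 (@rapid_lower R) (@rapid_raise R).
have H3 := dominated_adjoint w w2 ll idr.
have H4 := dominated_adjoint w (tempered_natM 0 w_tempered) idr idr.
have H5 := dominated_adjoint w w_tempered (@rapid_raise R) (@rapid_raise R).
have H6 := dominated_adjoint w (tempered_natM 1 w1) idr idr.
have H7 := dominated_adjoint w w_tempered (@rapid_lower R) (@rapid_raise R).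
have H8 := dominated_adjoint w w1 ll idr.
have H9 := dominated_adjoint w w_tempered ll idr.
have H10 := dominated_adjoint w wm (@rapid_lower R) (@rapid_lower R).
have D2 := symbol_diff2 tw; have D1 := symbol_diff1 tw.
have S3 : symbol_of_order w 2 (fun k => w k.+3 - w k.+2 - w k.+1 + w k).
  by apply: eq_symbol (symbolD D2 (symbol_succ tw D2)) => k /=; ring.
have E3 := symbolM (sqrt_growth 1) (symbolM (sqrtM_growth 2 3) (symbolZ 2 S3)).
have E1 : symbol_of_order w 1 (fun k =>
    2 * k.+2%:R * w k.+2 - 2 * k.+1%:R * (w k + w k.+1) + 2 * k%:R * w k.-1).
  apply: (symbol_of_succ tw).
  have T2 := symbolM (nat_growth 2) (symbolZ 2 S3).
  have T1 := symbolZ 2 (symbolD (symbol_succ tw symbol_diff_two) D1).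
  apply: eq_symbol (symbolD T2 T1) => k /=.
  by rewrite add2n -!natr1; ring.
have E1' := symbolM (sqrt_growth 1) E1.
have H := dominatedD (dominatedZ 2 (dominatedD H1 (dominatedD H2 H3)))
  (dominatedD (dominatedD (dominatedZ (- 2) H4) (dominatedZ 2 (dominatedD H5 H6)))
  (dominatedD (dominatedD (dominatedZ (- 2) (dominatedD H7 H8))
    (dominatedZ (- 2) (dominatedD H9 H10)))
    (dominatedD (dominated_entry tw 3 E3) (dominated_entry tw 1 E1')))).
apply: eq_dominated H => c k /=.
by rewrite !raise_lower !lower_raise /lower !add0n !add1n !add2n -!natr1; ring.
Qed.

End MainForms.

(** * The Hermite-Sobolev weights *)

Section HermiteWeight.
Context {R : realType}.

Lemma natDM_gt0 (k : nat) : 0 < (2 * k + 1)%:R :> R.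
Proof. by rewrite ltr0n addn1. Qed.

Lemma MVT_powR (q x y : R) : 0 < x -> x < y ->
  exists2 z, x < z < y & y `^ q - x `^ q = q * z `^ (q - 1) * (y - x).
Proof.
move=> x0 xy.
have D (z : R) : x <= z -> is_derive z 1 (fun t : R => t `^ q) (q * z `^ (q - 1)).
  by move=> xz; apply: is_derive1_powR; exact: lt_le_trans xz.
have [||z] := @MVT R (fun t : R => t `^ q) (fun z => q * z `^ (q - 1)) x y xy.
- by move=> z; rewrite in_itv/= => /andP[/ltW xz _]; exact: D.
- apply: derivable_within_continuous => z /=; rewrite in_itv/= => /andP[xz _].
  by have [] := D z xz.
- by rewrite in_itv/= => xzy e; exists z.
Qed.

(** The mean value theorem for the increment [t |-> (t + h) ^ q - t ^ q] and
    then for its derivative. *)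
Lemma MVT2_powR (q x h : R) : 0 < x -> 0 < h ->
  exists2 z, x < z < x + 2 * h &
  (x + 2 * h) `^ q - 2 * (x + h) `^ q + x `^ q = q * (q - 1) * z `^ (q - 2) * h ^+ 2.
Proof.
move=> x0 h0.
pose F t := (t + h) `^ q - t `^ q.
have D (t : R) : 0 < t -> is_derive t 1 F (q * ((t + h) `^ (q - 1) - t `^ (q - 1))).
  move=> t0; rewrite mulrBr.
  apply: is_deriveB; last exact: is_derive1_powR.
  have E1 : is_derive (t + h) 1 (fun t : R => t `^ q) (q * (t + h) `^ (q - 1)).
    by apply: is_derive1_powR; rewrite addr_gt0.
  have E2 : is_derive t 1 (fun t : R => t + h) 1.
    by apply: is_derive_eq; rewrite addr0.
  have := @is_derive1_comp R (fun t : R => t `^ q) (fun t => t + h) t _ _ E1 E2.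
  by rewrite mulr1.
have [|||t] := @MVT R F (fun t => q * ((t + h) `^ (q - 1) - t `^ (q - 1))) x (x + h).
- by rewrite ltrDl.
- move=> t; rewrite in_itv/= => /andP[xt _]; apply: D; exact: lt_trans xt.
- apply: derivable_within_continuous => t; rewrite in_itv/= => /andP[xt _].
  by have [] := D t (lt_le_trans x0 xt).
- rewrite in_itv/= => /andP[xt txh] e.
have t0 : 0 < t by exact: lt_trans xt.
have [|z /andP[tz zth] e2] := @MVT_powR (q - 1) t (t + h) t0; first by rewrite ltrDl.
exists z.
  by rewrite (lt_trans xt tz)/= (lt_trans zth)// [_ * h]mulr_natl mulr2n addrA ltrD2r.
move: e; rewrite e2 /F.
have -> : x + h + h = x + 2 * h by ring.
have -> : q - 1 - 1 = q - 2 by ring.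
have -> : x + h - x = h by ring.
have -> : t + h - t = h by ring.
by move=> e; apply: etrans (etrans e _); ring.
Qed.

(** With [x = 2 k + 1], the intermediate points [z] of the mean value theorems
    satisfy [x < z <= 5 x], so that [z ^ (q - n)] is at most
    [5 ^ q * x ^ q / x ^ n]. *)
Lemma odd_powR_tame (q : R) : 0 <= q ->
  tame_weight (fun k => (2 * k + 1)%:R `^ q).
Proof.
move=> q0.
have monoq (x y : R) : 0 <= x -> x <= y -> x `^ q <= y `^ q.
  by move=> x0 xy; apply: ge0_ler_powR => //; rewrite nnegrE// (le_trans x0).
have S1 k : (2 * k.+1 + 1)%:R = (2 * k + 1)%:R + 2 :> R.
  by rewrite -natrD; congr _%:R; lia.
have S2 k : (2 * k.+2 + 1)%:R = (2 * k + 1)%:R + 2 * 2 :> R.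
  by rewrite -!natrM -natrD; congr _%:R; lia.
have kle k : k.+1%:R <= (2 * k + 1)%:R :> R by rewrite ler_nat; lia.
have x1 k : 1 <= (2 * k + 1)%:R :> R by rewrite ler1n; lia.
split.
- by move=> k; rewrite powR_gt0.
- by move=> k; apply: monoq => //; rewrite ler_nat; lia.
- have [N hN] : exists N : nat, q <= N%:R.
    by exists (Num.bound q); rewrite ltW// archi_boundP.
  exists N, (2 ^+ N) => k; rewrite ger0_norm ?powR_ge0//.
  apply: le_trans (ler_powR (x1 k) hN) _; rewrite powR_mulrn//.
  rewrite -exprMn lerXn2r ?nnegrE ?mulr_ge0// -natrM ler_nat; lia.
- exists (2 * q * 3 `^ q) => k; rewrite S1.
  set x := (2 * k + 1)%:R.
  have x0 : 0 < x by exact: natDM_gt0.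
  have [|z /andP[xz zx] ->] := @MVT_powR q x (x + 2) x0; first by rewrite ltrDl.
  have z0 := lt_trans x0 xz.
  have zn : z != 0 by rewrite gt_eqF.
  rewrite expr1 powRB ?zn ?implybT// powRr1 ?(ltW z0)//.
  have -> : x + 2 - x = 2 by ring.
  rewrite ger0_norm ?mulr_ge0 ?invr_ge0 ?powR_ge0 ?(ltW z0)//.
  have zq : z `^ q <= 3 `^ q * x `^ q.
    rewrite -powRM ?(ltW x0)//; apply: monoq; first exact: ltW.
    have := x1 k; rewrite -/x; lra.
  have kz : k.+1%:R / z <= 1.
    by rewrite ler_pdivrMr// mul1r (le_trans (kle k))// ltW.
  have -> : q * (z `^ q / z) * 2 * k.+1%:R = 2 * q * (z `^ q * (k.+1%:R / z)) by ring.
  rewrite -[leRHS]mulrA ler_wpM2l ?mulr_ge0//.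
  by rewrite (le_trans _ zq)// ler_piMr ?powR_ge0.
- exists (4 * (q * `|q - 1|) * 5 `^ q) => k; rewrite S2 S1.
  set x := (2 * k + 1)%:R.
  have x0 : 0 < x by exact: natDM_gt0.
  have [//|z /andP[xz zx] ->] := @MVT2_powR q x 2 x0.
  have z0 := lt_trans x0 xz.
  have zn : z != 0 by rewrite gt_eqF.
  rewrite powRB ?zn ?implybT// powR_mulrn ?(ltW z0)//.
  rewrite 4!normrM (ger0_norm q0) (ger0_norm (powR_ge0 _ _)).
  rewrite [`|(z ^+ 2)^-1|]ger0_norm ?invr_ge0 ?exprn_ge0 ?(ltW z0)//.
  rewrite [`|2 ^+ 2|]ger0_norm ?exprn_ge0//.
  have zq : z `^ q <= 5 `^ q * x `^ q.
    rewrite -powRM ?(ltW x0)//; apply: monoq; first exact: ltW.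
    have := x1 k; rewrite -/x; lra.
  have kz : k.+1%:R ^+ 2 / z ^+ 2 <= 1.
    rewrite ler_pdivrMr ?exprn_gt0// mul1r lerXn2r ?nnegrE ?(ltW z0)//.
    by rewrite (le_trans (kle k))// ltW.
  have -> : q * `|q - 1| * (z `^ q / z ^+ 2) * 2 ^+ 2 * k.+1%:R ^+ 2
     = 4 * (q * `|q - 1|) * (z `^ q * (k.+1%:R ^+ 2 / z ^+ 2)) by ring.
  rewrite -[leRHS]mulrA ler_wpM2l ?mulr_ge0//.
  by rewrite (le_trans _ zq)// ler_piMr ?powR_ge0.
Qed.

End HermiteWeight.

(** * The operator A on coefficient sequences *)

Section SequenceOperator.
Context {R : realType}.
Implicit Types (a b : R) (c w : nat -> R).

Let rho : R := (Num.sqrt 2)^-1.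

Lemma sqr_rho : rho ^+ 2 = 2^-1.
Proof. by rewrite /rho exprVn sqr_sqrtr. Qed.

Definition seqD c (k : nat) : R := (Num.sqrt 2)^-1 * (lower c k - raise c k).

Definition seqX c (k : nat) : R := (Num.sqrt 2)^-1 * (lower c k + raise c k).

(** The action on Hermite coefficients of [phi |-> - ((a x + b) phi)'], written
    in terms of [T] and [U]; see [seqAE] and [hermite_coef_Astar]. *)
Definition seqA a b c (k : nat) : R :=
  a / 2 * (raise (raise c) k - lower (lower c) k - c k)
  + b * (Num.sqrt 2)^-1 * (raise c k - lower c k).

Lemma raise2_lower c k : raise (raise (lower c)) k = (k%:R - 1) * raise c k.
Proof.
rewrite (eq_raise (raise_lower c)); case: k => [|k].
  by rewrite !raise0 mulr0.
by rewrite !raiseS -natr1; ring.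
Qed.

Lemma raise2_lower2 c k :
  raise (raise (lower (lower c))) k = k%:R * (k%:R - 1) * c k.
Proof. by rewrite raise2_lower raise_lower; ring. Qed.

Lemma lower2_raise c k : lower (lower (raise c)) k = (k%:R + 2) * lower c k.
Proof. by rewrite (eq_lower (lower_raise c)) /lower -!natr1; ring. Qed.

Lemma lower2_raise2 c k :
  lower (lower (raise (raise c))) k = (k%:R + 2) * (k%:R + 1) * c k.
Proof. by rewrite lower2_raise lower_raise -natr1; ring. Qed.

(** [(l - r) (l + r) = l l - r r + 1], because [l r - r l = 1]. *)
Lemma seqAE a b c k :
  - (a * seqD (seqX c) k + b * seqD c k) = seqA a b c k.
Proof.
have e1 : seqD (seqX c) k = rho ^+ 2 *
    (lower (lower c) k + lower (raise c) k - raise (lower c) k - raise (raise c) k).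
  by rewrite /seqD /seqX /lower /raise -/rho /=; ring.
by rewrite e1 sqr_rho lower_raise raise_lower -natr1 /seqD /seqA -/rho; field.
Qed.

Lemma raise_seqA a b c : raise (seqA a b c) = (fun k =>
  a / 2 * (raise (raise (raise c)) k - raise (lower (lower c)) k - raise c k)
  + b * rho * (raise (raise c) k - raise (lower c) k)).
Proof. by apply/funext => k; rewrite /seqA /lower /raise -/rho; ring. Qed.

Lemma lower_seqA a b c : lower (seqA a b c) = (fun k =>
  a / 2 * (lower (raise (raise c)) k - lower (lower (lower c)) k - lower c k)
  + b * rho * (lower (raise c) k - lower (lower c) k)).
Proof. by apply/funext => k; rewrite /seqA /lower /raise -/rho; ring. Qed.

(** The square of [(a / 2) (T - 1) + (b / sqrt 2) U]: the three groups are the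
    multiples of [(T - 1) (T - 1)], of [(T - 1) U + U (T - 1)] and of [U U]. *)
Lemma seqA_seqA a b c k : seqA a b (seqA a b c) k =
  a ^+ 2 / 4 * ((raise (raise (raise (raise c))) k
                 - (2 * k%:R ^+ 2 + 2 * k%:R + 2) * c k
                 + lower (lower (lower (lower c))) k)
                - 2 * (raise (raise c) k - lower (lower c) k) + c k)
  + a * b * rho / 2 * ((2 * raise (raise (raise c)) k - 2 * k%:R * raise c k
                - (2 * k%:R + 2) * lower c k + 2 * lower (lower (lower c)) k)
                - 2 * (raise c k - lower c k))
  + b ^+ 2 / 2 * (raise (raise c) k - (2 * k%:R + 1) * c k + lower (lower c) k).
Proof.
have r2 : raise (raise (seqA a b c)) k =
    a / 2 * (raise (raise (raise (raise c))) k
      - raise (raise (lower (lower c))) k - raise (raise c) k)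
    + b * rho * (raise (raise (raise c)) k - raise (raise (lower c)) k).
  by rewrite raise_seqA /lower /raise; ring.
have l2 : lower (lower (seqA a b c)) k =
    a / 2 * (lower (lower (raise (raise c))) k
      - lower (lower (lower (lower c))) k - lower (lower c) k)
    + b * rho * (lower (lower (raise c)) k - lower (lower (lower c)) k).
  by rewrite lower_seqA /lower /raise; ring.
rewrite [LHS]/seqA r2 l2 raise_seqA lower_seqA -/rho.
have -> : b ^+ 2 / 2 = b ^+ 2 * rho ^+ 2 by rewrite sqr_rho.
rewrite raise2_lower2 raise2_lower lower2_raise2 lower2_raise.
rewrite !raise_lower !lower_raise /seqA -/rho -!natr1.
by field.
Qed.

(** The monotonicity inequality on coefficient sequences.  Replacing [T] by
    [T - 1] in the second-order forms only changes them by multiples of the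
    first-order ones, which explains the coefficients in the combination. *)
Lemma dominated_monotone w a b g d : tame_weight w ->
  dominated w (fun c k =>
    w k * (2 * c k * (2^-1 * seqA a b (seqA a b c) k - a / 2 * seqA a b c k
           + seqA g d c k) + seqA a b c k ^+ 2)).
Proof.
move=> tw.
have H0 := dominated_weight tw.
have H1 := dominated_form_U tw.
have H2 := dominated_form_T tw.
have H11 := dominated_form_UU tw.
have H22 := dominated_form_TT tw.
have H12 := dominated_form_TU tw.
have H := dominatedD (dominatedD (dominatedZ (a ^+ 2 / 4) H22)
    (dominatedD (dominatedZ (a * b * rho / 2) H12) (dominatedZ (b ^+ 2 / 2) H11)))
  (dominatedD (dominatedZ (g - 3 / 2 * a ^+ 2) H2)
   (dominatedD (dominatedZ (2 * d * rho - 3 * a * b * rho) H1)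
     (dominatedZ (a ^+ 2 - g) H0))).
apply: eq_dominated H => c k /=.
rewrite seqA_seqA /seqA -/rho.
have -> : b ^+ 2 / 2 = b ^+ 2 * rho ^+ 2 by rewrite sqr_rho.
by field.
Qed.

End SequenceOperator.

(** * The Schwartz class *)

Section Schwartz.
Context {R : realType}.
Implicit Types (f g : R -> R).

Lemma schwartz_is_derive f n (x : R) : schwartz f ->
  is_derive x 1 (derive1n n f) (derive1n n.+1 f x).
Proof.
move=> [df _]; rewrite derive1nS derive1E; apply/derivableP; exact: df.
Qed.

Lemma schwartz_is_derive1 f (x : R) : schwartz f ->
  is_derive x 1 f (derive1 f x).
Proof. by move=> sf; have := schwartz_is_derive 0 x sf. Qed.

Lemma schwartz_bound f m n : schwartz f ->
  exists C : R, forall x, `|x ^+ m * derive1n n f x| <= C.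
Proof. by case=> _; apply. Qed.

(** A family of functions stable under differentiation and whose members
    decay rapidly consists of Schwartz functions. *)
Lemma schwartz_derivs f (F : nat -> R -> R) : F 0%N = f ->
  (forall n (x : R), is_derive x 1 (F n) (F n.+1 x)) ->
  (forall m n, exists C : R, forall x : R, `|x ^+ m * F n x| <= C) -> schwartz f.
Proof.
move=> F0 dF bF.
have FE n : derive1n n f = F n.
  elim: n => [|n ih]; first by rewrite derive1n0.
  rewrite derive1nS ih; apply/funext => x.
  by rewrite derive1E (@derive_val _ _ _ _ _ _ _ (dF n x)).
split; last by move=> m n; rewrite FE; exact: bF.
by move=> n x; rewrite FE; have [] := dF n x.
Qed.

Lemma schwartz_derive1 f : schwartz f -> schwartz (derive1 f).
Proof.
move=> sf; apply: (@schwartz_derivs _ (fun n => derive1n n.+1 f)).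
- exact: derive1n1.
- by move=> n x; exact: schwartz_is_derive.
- by move=> m n; exact: schwartz_bound.
Qed.

Lemma schwartz_lin (a b : R) f g : schwartz f -> schwartz g ->
  schwartz (fun x => a * f x + b * g x).
Proof.
move=> sf sg.
apply: (@schwartz_derivs _ (fun n x => a * derive1n n f x + b * derive1n n g x)) => //.
- move=> n x.
  have Hf := is_deriveZ a (schwartz_is_derive n x sf).
  have Hg := is_deriveZ b (schwartz_is_derive n x sg).
  exact: is_deriveD Hf Hg.
- move=> m n; have [C hC] := schwartz_bound m n sf; have [D hD] := schwartz_bound m n sg.
  exists (`|a| * C + `|b| * D) => x.
  rewrite mulrDr; apply: le_trans (ler_normD _ _) _.
  by apply: lerD; rewrite mulrCA normrM ler_wpM2l.
Qed.

Lemma schwartzZ (a : R) f : schwartz f -> schwartz (fun x => a * f x).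
Proof.
move=> sf; have := schwartz_lin a 0 sf sf.
by under eq_fun do rewrite mul0r addr0.
Qed.

(** The [n]-th derivative of [x * f x] is [x * f^(n) x + n * f^(n - 1) x]; for
    [n = 0] the truncated index [n.-1] is harmless, its coefficient being
    zero. *)
Lemma schwartz_mulX f : schwartz f -> schwartz (fun x => x * f x).
Proof.
move=> sf.
apply: (@schwartz_derivs _
  (fun n x => x * derive1n n f x + n%:R * derive1n n.-1 f x)).
- by apply/funext => x; rewrite mul0r addr0.
- move=> n x.
  have H1 := is_deriveM (@is_derive_id _ _ x 1) (schwartz_is_derive n x sf).
  have H2 : is_derive x 1 (fun x => n%:R * derive1n n.-1 f x) (n%:R * derive1n n f x).
    case: n {H1} => [|n]; last exact: is_deriveZ (schwartz_is_derive n x sf).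
    by under eq_fun do rewrite mul0r; rewrite mul0r; exact: is_derive_cst.
  have H := is_deriveD H1 H2.
  apply: is_derive_eq; rewrite /GRing.scale/= -natr1; ring.
- move=> m n; have [C hC] := schwartz_bound m.+1 n sf.
  have [D hD] := schwartz_bound m n.-1 sf.
  exists (C + n%:R * D) => x.
  rewrite mulrDr; apply: le_trans (ler_normD _ _) _.
  apply: lerD; first by rewrite mulrA -exprSr.
  by rewrite mulrCA normrM normr_nat ler_wpM2l.
Qed.

Lemma schwartz_mulA (a b : R) f : schwartz f -> schwartz (fun x => (a * x + b) * f x).
Proof.
move=> sf; have := schwartz_lin a b (schwartz_mulX sf) sf.
by under eq_fun do rewrite mulrA -mulrDl.
Qed.

Lemma schwartz_Astar (a b : R) f : schwartz f -> schwartz (Astar (fun x => a * x + b) f).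
Proof.
move=> sf; have := schwartzZ (-1) (schwartz_derive1 (schwartz_mulA a b sf)).
by under eq_fun do rewrite mulN1r.
Qed.

Lemma derive1_affineM (a b : R) f : schwartz f ->
  derive1 (fun x => (a * x + b) * f x) = (fun x => a * f x + (a * x + b) * derive1 f x).
Proof.
move=> sf; apply/funext => x.
have H1 : is_derive x 1 (fun x : R => a * x + b) a.
  by apply: is_derive_eq; rewrite /GRing.scale/=; ring.
rewrite derive1E.
apply: etrans (@derive_val _ _ _ _ _ _ _ (is_deriveM H1 (schwartz_is_derive1 x sf))) _.
by rewrite /GRing.scale/=; ring.
Qed.

Lemma derive1_lin (a b : R) f g : schwartz f -> schwartz g ->
  derive1 (fun x => a * f x + b * g x) = (fun x => a * derive1 f x + b * derive1 g x).
Proof.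
move=> sf sg; apply/funext => x.
have Hf := is_deriveZ a (schwartz_is_derive1 x sf).
have Hg := is_deriveZ b (schwartz_is_derive1 x sg).
by rewrite derive1E; exact: (@derive_val _ _ _ _ _ _ _ (is_deriveD Hf Hg)).
Qed.

(** ** Decay of Gaussian functions *)

(** [exp t >= 1 + t ^ m / m!] at [t = x ^ 2 / 2] bounds [x ^ (2 m)], which
    dominates [|x| ^ m] outside the unit ball. *)
Lemma expr_gauss_bound (m : nat) (x : R) :
  `|x ^+ m * expR (- (x ^+ 2 / 2%:R))| <= 1 + 2 ^+ m * m`!%:R.
Proof.
rewrite normrM (ger0_norm (expR_ge0 _)) normrX expRN ler_pdivrMr ?expR_gt0//.
set t := x ^+ 2 / 2%:R; have t0 : 0 <= t by rewrite divr_ge0 ?sqr_ge0.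
have h1 : `|x| ^+ m <= 1 + (x ^+ 2) ^+ m.
  have [xl|xg] := lerP `|x| 1.
    by rewrite (@le_trans _ _ 1)// ?exprn_ile1// lerDl exprn_ge0 ?sqr_ge0.
  rewrite -[x ^+ 2]real_normK ?num_real// -exprM ler_wpDl//.
  by apply: ler_weXn2l; [exact: ltW|rewrite leq_pmull].
have h2 : (x ^+ 2) ^+ m <= 2 ^+ m * m`!%:R * expR t.
  have -> : (x ^+ 2) ^+ m = 2 ^+ m * t ^+ m by rewrite -exprMn /t mulrC divfK.
  rewrite -mulrA ler_wpM2l ?exprn_ge0//.
  case: m {h1} => [|m]; first by rewrite expr0 fact0 mul1r -expR0 ler_expR.
  rewrite mulrC -ler_pdivrMr ?ltr0n ?fact_gt0//.
  by apply: le_trans (expR_ge1Dxn m t0); rewrite lerDr.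
have h3 : 1 <= expR t by rewrite -expR0 ler_expR.
by rewrite mulrDl mul1r (le_trans h1)// lerD.
Qed.

Lemma poly_gauss_bound (p : {poly R}) : exists C : R, forall x,
  `|p.[x] * expR (- (x ^+ 2 / 2%:R))| <= C.
Proof.
exists (\sum_(i < size p) `|p`_i| * (1 + 2 ^+ i * (i`!)%:R)) => x.
rewrite horner_coef mulr_suml; apply: le_trans (ler_norm_sum _ _ _) _.
apply: ler_sum => i _; rewrite -mulrA normrM ler_wpM2l//.
exact: expr_gauss_bound.
Qed.

Lemma is_derive_poly_gauss (p : {poly R}) (x : R) :
  is_derive x 1 (fun x => p.[x] * expR (- (x ^+ 2 / 2%:R)))
    ((deriv p - 'X * p).[x] * expR (- (x ^+ 2 / 2%:R))).
Proof.
have E : is_derive x 1 (expR \o (fun z : R => - (z ^+ 2 / 2%:R)))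
    (expR (- (x ^+ 2 / 2%:R)) * - x).
  apply: is_derive1_comp; apply: is_derive_eq.
  by rewrite /GRing.scale /=; field.
have H := is_deriveM (is_derive_poly p x) E.
apply: is_derive_eq.
by rewrite hornerD hornerN hornerM hornerX /GRing.scale/=; ring.
Qed.

Lemma schwartz_poly_gauss (p : {poly R}) :
  schwartz (fun x => p.[x] * expR (- (x ^+ 2 / 2%:R))).
Proof.
pose P n := iter n (fun q : {poly R} => deriv q - 'X * q) p.
apply: (@schwartz_derivs _ (fun n x => (P n).[x] * expR (- (x ^+ 2 / 2%:R)))) => //.
- by move=> n x; exact: is_derive_poly_gauss.
- move=> m n; have [C hC] := poly_gauss_bound ('X^m * P n).
  by exists C => x; rewrite mulrA; have := hC x; rewrite hornerM hornerXn.
Qed.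

End Schwartz.

(** * Integration by parts on the line *)

Section Integration.
Context {R : realType}.
Notation mu := (@lebesgue_measure R).
Implicit Types (f g F : R -> R).

Definition quadratic_decay f := exists C : R, forall x, `|f x| * (1 + x ^+ 2) <= C.

Lemma integrable_oneDsqrV : mu.-integrable setT (EFin \o (fun x : R => (oneDsqr x)^-1)).
Proof.
have c : continuous (fun x : R => (oneDsqr x)^-1) by exact: continuous_oneDsqrV.
apply/integrableP; split.
  by apply/measurable_EFinP; exact: continuous_measurable_fun.
have p (x : R) : 0 <= (oneDsqr x)^-1 by rewrite invr_ge0.
under eq_integral do rewrite /= ger0_norm//.
rewrite ge0_symfun_integralT//; last by move=> x /=; rewrite /oneDsqr sqrrN.
by rewrite -set_itvcy integral0y_oneDsqr -EFinM ltry.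
Qed.

Lemma quadratic_decay_integrable f : continuous f -> quadratic_decay f ->
  mu.-integrable setT (EFin \o f).
Proof.
move=> cf [C hC].
apply: le_integrable (integrableZl measurableT C integrable_oneDsqrV) => //.
  by apply/measurable_EFinP; exact: continuous_measurable_fun.
move=> x _ /=; rewrite lee_fin.
by rewrite (le_trans _ (ler_norm _))// ler_pdivlMr ?oneDsqr_gt0.
Qed.

(** The integral of [f] over [[- n, n]] is [F n - F (- n)], which tends to [0]
    by the decay of [F], while dominated convergence identifies its limit. *)
Lemma Rintegral_derive0 F f : (forall x : R, is_derive x 1 F (f x)) ->
  continuous f -> quadratic_decay F -> quadratic_decay f ->
  \int[mu]_x f x = 0.
Proof.
move=> dF cf [C hC] df.
have [D hD] := df.
pose I n : set R := `[- n.+1%:R, n.+1%:R].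
have mI n : measurable (I n) by exact: measurable_itv.
have h1 : (\int[mu]_x ((f \_ (I n)) x)%:E)%E @[n --> \oo] --> (\int[mu]_x (f x)%:E)%E.
  have mf : measurable_fun setT f by exact: continuous_measurable_fun.
  apply: (@dominated_cvg _ _ _ mu setT measurableT
    (fun n x => ((f \_ (I n)) x)%:E) (EFin \o f) (fun x => (`|f x|)%:E)).
  - move=> n; apply/measurable_EFinP/(measurable_restrictT _ (mI n)).
    exact: measurable_funS mf.
  - move=> x _; apply: cvg_EFin; first exact: nearW.
    apply: cvg_near_cst; exists (Num.bound `|x|) => // n /= xn.
    rewrite /restrict mem_set//= /I /= in_itv/= -ler_norml.
    apply: le_trans (ltW (archi_boundP _)) _ => //.
    by rewrite ler_nat (leq_trans xn)// leqnSn.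
  - by [].
  - have := quadratic_decay_integrable cf df; exact: integrable_norm.
  - move=> n x _ /=; rewrite lee_fin /restrict; case: ifPn => // _.
    by rewrite normr0.
have FTC n : (\int[mu]_x ((f \_ (I n)) x)%:E)%E = (F n.+1%:R - F (- n.+1%:R))%:E.
  transitivity (\int[mu]_(x in I n) (f x)%:E)%E.
    by rewrite [RHS]integral_mkcond; under [RHS]eq_integral do rewrite restrict_EFin.
  rewrite EFinB.
  have cF x : {for x, continuous F}.
    apply/differentiable_continuous; rewrite -derivable1_diffP.
    by have [] := dF x.
  apply: continuous_FTC2.
  - by rewrite -subr_gt0 opprK addr_gt0.
  - by apply: continuous_subspaceT => x; exact: cf.
  - split; first by move=> x _; have [] := dF x.
    + by apply: cvg_at_right_filter; exact: cF.
    + by apply: cvg_at_left_filter; exact: cF.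
  - by move=> x _; rewrite derive1E (@derive_val _ _ _ _ _ _ _ (dF x)).
have C0 : 0 <= C by apply: le_trans (hC 0); rewrite mulr_ge0// addr_ge0// sqr_ge0.
have bF (x : R) n : `|x| = n.+1%:R -> `|F x| <= C * harmonic n.
  move=> xn; rewrite /harmonic ler_pdivlMr// (le_trans _ (hC x))// ler_wpM2l//.
  rewrite -[x ^+ 2]real_normK ?num_real// xn -natrX -natr1 addrC lerD2l.
  rewrite ler_nat; lia.
have h2 : (F n.+1%:R - F (- n.+1%:R)) @[n --> \oo] --> (0 : R).
  apply/norm_cvg0P.
  apply: (@squeeze_cvgr _ _ _ _ (cst 0) (fun n => (C + C) * harmonic n)).
  - apply: nearW => n; rewrite normr_ge0/= (le_trans (ler_normB _ _))// mulrDl.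
    by rewrite lerD// bF// ?normrN normr_nat.
  - exact: cvg_cst.
  - by rewrite -[X in _ --> X](mulr0 (C + C)); apply: cvgMl_tmp; exact: cvg_harmonic.
rewrite /Rintegral.
suff -> : (\int[mu]_x (f x)%:E)%E = 0%:E by [].
have h3 : (\int[mu]_x ((f \_ (I n)) x)%:E)%E @[n --> \oo] --> 0%:E.
  by under eq_fun do rewrite FTC; apply: cvg_EFin => //; exact: nearW.
exact: (cvg_unique _ h1 h3).
Qed.

End Integration.

(** * Hermite coefficients *)

Section HermiteCoefficients.
Context {R : realType}.
Notation mu := (@lebesgue_measure R).
Implicit Types (f g F : R -> R).

Lemma schwartz_continuous f : schwartz f -> continuous f.
Proof.
move=> sf x; apply/differentiable_continuous; rewrite -derivable1_diffP.
by have [] := schwartz_is_derive1 x sf.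
Qed.

Lemma schwartzM_decay f g : schwartz f -> schwartz g ->
  quadratic_decay (fun x => f x * g x).
Proof.
move=> sf sg; have [C hC] := schwartz_bound 0 0 sf.
have [D hD] := schwartz_bound 0 0 sg; have [E hE] := schwartz_bound 2 0 sg.
exists (C * (D + E)) => x.
have h0 := hC x; rewrite expr0 mul1r derive1n0 in h0.
rewrite normrM -mulrA ler_pM ?mulr_ge0 ?addr_ge0 ?sqr_ge0//.
rewrite mulrDr mulr1 lerD//; first by have := hD x; rewrite expr0 mul1r.
by have := hE x; rewrite normrM mulrC (ger0_norm (sqr_ge0 x)).
Qed.

Lemma quadratic_decayD f g : quadratic_decay f -> quadratic_decay g ->
  quadratic_decay (fun x => f x + g x).
Proof.
move=> [C hC] [D hD]; exists (C + D) => x.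
apply: le_trans (lerD (hC x) (hD x)); rewrite -mulrDl ler_wpM2r ?ler_normD//.
by rewrite addr_ge0 ?sqr_ge0.
Qed.

Lemma schwartzM_integrable f g : schwartz f -> schwartz g ->
  mu.-integrable setT (EFin \o (fun x => f x * g x)).
Proof.
move=> sf sg; apply: quadratic_decay_integrable; last exact: schwartzM_decay.
by move=> x; apply: cvgM; exact: schwartz_continuous.
Qed.

Lemma ip0C f g : ip0 f g = ip0 g f.
Proof. by rewrite /ip0; apply: eq_Rintegral => x _; rewrite mulrC. Qed.

Lemma ip0_lin (a b : R) f g h : schwartz f -> schwartz g -> schwartz h ->
  ip0 (fun x => a * f x + b * g x) h = a * ip0 f h + b * ip0 g h.
Proof.
move=> sf sg sh; rewrite /ip0.
under eq_Rintegral do rewrite mulrDl -!mulrA.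
have if' := schwartzM_integrable sf sh; have ig := schwartzM_integrable sg sh.
rewrite RintegralD//; last 2 first.
- exact: (integrableZl measurableT a if').
- exact: (integrableZl measurableT b ig).
by rewrite !RintegralZl.
Qed.

Lemma ip0_linr (a b : R) f g h : schwartz f -> schwartz g -> schwartz h ->
  ip0 h (fun x => a * f x + b * g x) = a * ip0 h f + b * ip0 h g.
Proof. by move=> *; rewrite ip0C ip0_lin// ip0C [ip0 g h]ip0C. Qed.

Lemma ip0_mulX f g : ip0 (fun x => x * f x) g = ip0 f (fun x => x * g x).
Proof. by rewrite /ip0; apply: eq_Rintegral => x _; rewrite mulrCA mulrA. Qed.

Lemma ip0_derive1 f g : schwartz f -> schwartz g ->
  ip0 (derive1 f) g = - ip0 f (derive1 g).
Proof.
move=> sf sg; have sf' := schwartz_derive1 sf; have sg' := schwartz_derive1 sg.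
apply/eqP; rewrite -addr_eq0 -RintegralD//; last 2 first.
- exact: schwartzM_integrable.
- exact: schwartzM_integrable.
apply/eqP; apply: (@Rintegral_derive0 _ (fun x => f x * g x)).
- move=> x.
  have H := is_deriveM (schwartz_is_derive1 x sf) (schwartz_is_derive1 x sg).
  by apply: is_derive_eq; rewrite /GRing.scale/=; ring.
- move=> x; apply: cvgD; apply: cvgM; exact: schwartz_continuous.
- exact: schwartzM_decay.
- by apply: quadratic_decayD; exact: schwartzM_decay.
Qed.

(** From [2 |f g| <= f ^ 2 + g ^ 2] under the integral. *)
Lemma ip0_norm_le f g : schwartz f -> schwartz g ->
  `|ip0 f g| <= ip0 f f + ip0 g g.
Proof.
move=> sf sg; have if' := schwartzM_integrable sf sf.
have ig := schwartzM_integrable sg sg; have ifg := schwartzM_integrable sf sg.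
apply: le_trans (le_normr_Rintegral _ ifg) _ => //.
rewrite -RintegralD//; apply: le_Rintegral => //.
- exact: integrable_norm.
- exact: (integrableD measurableT if' ig).
move=> x _; rewrite normrM -!expr2 -(real_normK (num_real (f x))) -(real_normK (num_real (g x))).
have := sqr_ge0 (`|f x| - `|g x|); rewrite sqrrB !expr2.
have := normr_ge0 (f x); have := normr_ge0 (g x); nra.
Qed.

(** ** The ladder relations *)

Lemma hermiteS n : hermite R n.+1 = 2%:R * 'X * hermite R n - deriv (hermite R n).
Proof. by rewrite /= -mul_polyC polyC_natr mulrA. Qed.

Lemma deriv_natM (m : nat) (p : {poly R}) : deriv (m%:R * p) = m%:R * deriv p.
Proof. by rewrite !mulr_natl derivMn. Qed.

Lemma deriv_hermite n : deriv (hermite R n.+1) = (2 * n.+1)%:R * hermite R n.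
Proof.
elim: n => [|n ih].
  have d1 : deriv (1 : {poly R}) = 0 by rewrite -polyC1 derivC.
  by rewrite hermiteS [hermite R 0]/(1 : {poly R}) !mulr1 d1 subr0 deriv_natM derivX mulr1 muln1.
rewrite [hermite R n.+2]hermiteS derivB -mulrA deriv_natM derivM derivX ih deriv_natM.
rewrite [hermite R n.+1]hermiteS !natrM -!natr1; ring.
Qed.

Lemma schwartz_hermite k : schwartz (@hermite_fun R k).
Proof.
have := schwartzZ (Num.sqrt (2%:R ^+ k * (k`!)%:R * Num.sqrt pi))^-1
  (schwartz_poly_gauss (hermite R k)).
congr schwartz; apply/funext => x; rewrite /hermite_fun; ring.
Qed.

Let nrm k : R := (Num.sqrt (2%:R ^+ k * (k`!)%:R * Num.sqrt pi))^-1.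

Lemma nrmS k : nrm k = nrm k.+1 * (Num.sqrt 2 * Num.sqrt k.+1%:R).
Proof.
rewrite /nrm -sqrtrM//.
have h1 : 0 < 2%:R ^+ k * (k`!)%:R * Num.sqrt pi :> R.
  by rewrite !mulr_gt0 ?exprn_gt0 ?ltr0n ?fact_gt0 ?sqrtr_gt0 ?pi_gt0.
have -> : 2%:R ^+ k.+1 * (k.+1`!)%:R * Num.sqrt pi =
  (2 * k.+1%:R) * (2%:R ^+ k * (k`!)%:R * Num.sqrt pi) :> R.
  by rewrite factS natrM exprS; ring.
have A0 : 0 < 2 * k.+1%:R :> R by rewrite mulr_gt0.
by rewrite (sqrtrM (2%:R ^+ k * (k`!)%:R * Num.sqrt pi) (ltW A0)) invfM [RHS]mulrAC mulVf ?mul1r//.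
Qed.

Lemma derive1_hermite_fun k x : derive1 (@hermite_fun R k) x =
  nrm k * ((deriv (hermite R k)).[x] - x * (hermite R k).[x])
  * expR (- (x ^+ 2 / 2%:R)).
Proof.
have := is_deriveZ (nrm k) (is_derive_poly_gauss (hermite R k) x).
move=> /(@derive_val _ _ _ _ _ _ _); rewrite derive1E.
rewrite hornerD hornerN hornerM hornerX => H.
rewrite -[RHS]mulrA -[RHS]H; congr ('D_1 _ x); apply/funext => t.
by rewrite /hermite_fun -mulrA [expR _ * _]mulrC.
Qed.

(** This is the recurrence defining the Hermite polynomials: the Gaussian
    factor contributes [- x] to the logarithmic derivative. *)
Lemma hermite_fun_raise k x :
  x * hermite_fun k x - derive1 (@hermite_fun R k) x
  = Num.sqrt 2 * Num.sqrt k.+1%:R * hermite_fun k.+1 x.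
Proof.
rewrite derive1_hermite_fun /hermite_fun -!/(nrm _) nrmS hermiteS.
by rewrite hornerD hornerN !hornerM hornerX -polyC_natr hornerC; ring.
Qed.

(** The two terms in [x] cancel, and [deriv_hermite] gives the result. *)
Lemma hermite_fun_lower k x :
  x * hermite_fun k x + derive1 (@hermite_fun R k) x
  = Num.sqrt 2 * Num.sqrt k%:R * hermite_fun k.-1 x.
Proof.
rewrite derive1_hermite_fun /hermite_fun -!/(nrm _).
case: k => [|k]; first by rewrite sqrtr0 /= -polyC1 derivC horner0; ring.
rewrite deriv_hermite hornerM -polyC_natr hornerC [nrm k.+1.-1]nrmS.
have -> : (2 * k.+1)%:R = (Num.sqrt 2 * Num.sqrt k.+1%:R) ^+ 2 :> R.
  by rewrite exprMn !sqr_sqrtr// natrM.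
by rewrite /=; ring.
Qed.

(** ** Action of multiplication and differentiation on coefficients *)

Definition hermite_coef f (k : nat) : R := ip0 f (@hermite_fun R k).

Lemma hermite_coef_lin (a b : R) f g k : schwartz f -> schwartz g ->
  hermite_coef (fun x => a * f x + b * g x) k =
  a * hermite_coef f k + b * hermite_coef g k.
Proof. by move=> sf sg; apply: ip0_lin => //; exact: schwartz_hermite. Qed.

Lemma ip0Z (a : R) f g : schwartz f -> schwartz g ->
  ip0 f (fun x => a * g x) = a * ip0 f g.
Proof.
move=> sf sg; have := ip0_linr a 0 sg sg sf.
by under eq_fun do rewrite mul0r addr0; rewrite mul0r addr0.
Qed.

Lemma hermite_coef_XD f k (s : R) : schwartz f ->
  hermite_coef (fun x => x * f x) k - s * hermite_coef (derive1 f) k =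
  ip0 f (fun x => x * hermite_fun k x + s * derive1 (@hermite_fun R k) x).
Proof.
move=> sf; have sh := @schwartz_hermite k.
rewrite /hermite_coef ip0_mulX ip0_derive1// mulrN opprK.
have := ip0_linr 1 s (schwartz_mulX sh) (schwartz_derive1 sh) sf.
by under eq_fun do rewrite mul1r; rewrite mul1r.
Qed.

Lemma hermite_coef_lower f k : schwartz f ->
  hermite_coef (fun x => x * f x) k + hermite_coef (derive1 f) k =
  Num.sqrt 2 * lower (hermite_coef f) k.
Proof.
move=> sf; have := hermite_coef_XD k (-1) sf; rewrite mulN1r opprK => ->.
under eq_fun do rewrite mulN1r hermite_fun_raise.
by rewrite ip0Z// ?mulrA//; exact: schwartz_hermite.
Qed.

Lemma hermite_coef_raise f k : schwartz f ->
  hermite_coef (fun x => x * f x) k - hermite_coef (derive1 f) k =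
  Num.sqrt 2 * raise (hermite_coef f) k.
Proof.
move=> sf; have := hermite_coef_XD k 1 sf; rewrite mul1r => ->.
under eq_fun do rewrite mul1r hermite_fun_lower.
by rewrite ip0Z// ?mulrA//; exact: schwartz_hermite.
Qed.

Lemma invr_sqrt2 : (Num.sqrt 2)^-1 = Num.sqrt 2 / 2 :> R.
Proof.
have s2 : Num.sqrt 2 * Num.sqrt 2 = 2 :> R by rewrite -expr2 sqr_sqrtr.
have s0 : Num.sqrt 2 != 0 :> R by rewrite gt_eqF ?sqrtr_gt0.
by apply: (mulfI s0); rewrite divff// mulrA s2 divff.
Qed.

Lemma hermite_coef_X f : schwartz f ->
  hermite_coef (fun x => x * f x) = seqX (hermite_coef f).
Proof.
move=> sf; apply/funext => k; rewrite /seqX invr_sqrt2.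
by rewrite mulrAC mulrDr -hermite_coef_lower// -hermite_coef_raise//; field.
Qed.

Lemma hermite_coef_D f : schwartz f ->
  hermite_coef (derive1 f) = seqD (hermite_coef f).
Proof.
move=> sf; apply/funext => k; rewrite /seqD invr_sqrt2.
by rewrite mulrAC mulrBr -hermite_coef_lower// -hermite_coef_raise//; field.
Qed.

(** ** Rapid decay of the coefficients *)

(** Both sides of [<(x - d/dx) h_k, h_(k+1)> = <h_k, (x + d/dx) h_(k+1)>] are
    computed by the ladder relations and carry the same factor.  This bounds
    the norms uniformly in [k] without evaluating a Gaussian integral. *)
Lemma ip0_hermite_cst k :
  ip0 (@hermite_fun R k) (@hermite_fun R k) = ip0 (@hermite_fun R 0) (@hermite_fun R 0).
Proof.
elim: k => // k <-.
have sh := schwartz_hermite.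
pose h := @hermite_fun R.
have uv : ip0 (fun x => x * h k x) (h k.+1) - ip0 (derive1 (h k)) (h k.+1) =
    Num.sqrt 2 * (Num.sqrt k.+1%:R * ip0 (h k) (h k)).
  exact: (hermite_coef_raise k.+1 (sh k)).
have : ip0 (fun x => x * h k x) (h k.+1) - ip0 (derive1 (h k)) (h k.+1) =
    Num.sqrt 2 * Num.sqrt k.+1%:R * ip0 (h k.+1) (h k.+1).
  rewrite -ip0Z ?sh// [RHS]ip0C.
  have := ip0_lin 1 (-1) (schwartz_mulX (sh k)) (schwartz_derive1 (sh k)) (sh k.+1).
  rewrite mul1r mulN1r => <-.
  congr (ip0 _ _); apply/funext => x.
  by rewrite mul1r mulN1r hermite_fun_raise.
by rewrite uv mulrA => /mulfI ->.
Qed.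

(** The Hermite functions are eigenvectors of [x ^ 2 - d^2 / dx^2]. *)
Lemma seqX2_seqD2 c k : seqX (seqX c) k - seqD (seqD c) k = (2 * k%:R + 1) * c k :> R.
Proof.
have -> : seqX (seqX c) k - seqD (seqD c) k = (Num.sqrt 2)^-1 ^+ 2 *
    (2 * lower (raise c) k + 2 * raise (lower c) k).
  by rewrite /seqX /seqD /lower /raise; ring.
by rewrite sqr_rho lower_raise raise_lower -natr1; field.
Qed.

(** Each application of [x ^ 2 - d^2 / dx^2] to [f] yields one more power of
    [2 k + 1] in the decay of its coefficients, which are bounded to start
    with. *)
Lemma rapid_hermite_coef f : schwartz f -> rapid (hermite_coef f).
Proof.
move=> sf N; elim: N f sf => [|N ih] f sf.
  exists (ip0 f f + ip0 (@hermite_fun R 0) (@hermite_fun R 0)) => k.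
  rewrite expr0 mulr1 -(ip0_hermite_cst k); apply: ip0_norm_le => //.
  exact: schwartz_hermite.
have sX := schwartz_mulX sf; have sXX := schwartz_mulX sX.
have sD := schwartz_derive1 sf; have sDD := schwartz_derive1 sD.
have [C hC] := ih _ (schwartz_lin 1 (-1) sXX sDD).
exists C => k; apply: le_trans (hC k).
rewrite hermite_coef_lin// hermite_coef_X// hermite_coef_X// hermite_coef_D// hermite_coef_D//.
rewrite mul1r mulN1r seqX2_seqD2 normrM exprS.
rewrite mulrCA mulrA ler_wpM2r ?natSX_ge0// ler_wpM2r//.
by rewrite ger0_norm ?addr_ge0 ?mulr_ge0// -natr1 lerD2r ler_peMl// ler1n.
Qed.

End HermiteCoefficients.

(** * Reduction of the inequality to coefficient sequences *)

Section Assembly.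
Context {R : realType}.
Implicit Types (f phi : R -> R) (a b p : R).

Lemma hermite_coef_Astar a b phi : schwartz phi ->
  hermite_coef (Astar (fun x => a * x + b) phi) = seqA a b (hermite_coef phi).
Proof.
move=> sphi; have sX := schwartz_mulX sphi.
have sXD := schwartz_derive1 sX; have sD := schwartz_derive1 sphi.
have -> : Astar (fun x => a * x + b) phi =
    (fun x => (- a) * derive1 (fun y => y * phi y) x + (- b) * derive1 phi x).
  apply/funext => x; rewrite /Astar.
  have -> : (fun y => (a * y + b) * phi y) = (fun y => a * (y * phi y) + b * phi y).
    by apply/funext => y; rewrite mulrA -mulrDl.
  by rewrite derive1_lin// opprD !mulNr.
apply/funext => k; rewrite hermite_coef_lin// !hermite_coef_D// hermite_coef_X//.
by rewrite -seqAE opprD !mulNr.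
Qed.

(** [(sigma ^ 2 phi)' = a sigma phi + sigma (sigma phi)'], so one further
    derivative turns both terms into values of [Astar].  The factors [1] fit
    the shape of the linearity lemmas. *)
Lemma LstarE a b g d phi : schwartz phi ->
  let sigma := fun x => a * x + b in
  Lstar sigma (fun x => g * x + d) phi =
  (fun x => 1 * (2^-1 * Astar sigma (Astar sigma phi) x
                 + (- (a / 2)) * Astar sigma phi x)
            + 1 * Astar (fun x => g * x + d) phi x).
Proof.
move=> sphi sigma; apply/funext => x.
pose f1 y := sigma y * phi y.
have sf1 : schwartz f1 := schwartz_mulA a b sphi.
pose f2 y := sigma y * derive1 f1 y.
have sf2 : schwartz f2 := schwartz_mulA a b (schwartz_derive1 sf1).
have e1 : derive1 (fun y => sigma y ^+ 2 * phi y) = (fun y => a * f1 y + 1 * f2 y).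
  have -> : (fun y => sigma y ^+ 2 * phi y) = (fun y => (a * y + b) * f1 y).
    by apply/funext => y; rewrite /f1 mulrA expr2.
  by rewrite derive1_affineM//; apply/funext => y; rewrite mul1r.
rewrite /Lstar derive1nS derive1n1 e1 derive1_lin// mul1r.
have e2 : Astar sigma (Astar sigma phi) x = derive1 f2 x.
  rewrite {1}/Astar.
  have -> : (fun y => sigma y * Astar sigma phi y) = (fun y => (-1) * f2 y + 0 * f2 y).
    by apply/funext => y; rewrite /Astar /f2 /f1; ring.
  by rewrite derive1_lin// ; ring.
by rewrite e2 /Astar -/f1; field.
Qed.

Lemma hermite_coef_Lstar a b g d phi : schwartz phi ->
  hermite_coef (Lstar (fun x => a * x + b) (fun x => g * x + d) phi) =
  (fun k => 2^-1 * seqA a b (seqA a b (hermite_coef phi)) k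
            - a / 2 * seqA a b (hermite_coef phi) k
            + seqA g d (hermite_coef phi) k).
Proof.
move=> sphi; have sA := schwartz_Astar a b sphi; have sB := schwartz_Astar g d sphi.
have sAA := schwartz_Astar a b sA.
rewrite LstarE//; apply/funext => k.
rewrite hermite_coef_lin//; last exact: schwartz_lin.
by rewrite hermite_coef_lin// !hermite_coef_Astar// !mul1r mulNr.
Qed.

Lemma hsipE p f g : hsip p f g =
  limn (series (fun k => (2 * k + 1)%:R `^ (2%:R * p)
                         * (hermite_coef f k * hermite_coef g k))).
Proof.
by rewrite /hsip; under [in RHS]eq_fun do rewrite mulrA.
Qed.

Lemma rapid_seqA a b (c : nat -> R) : rapid c -> rapid (seqA a b c).
Proof.
move=> rc; have rr := rapid_raise rc; have rl := rapid_lower rc.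
apply: rapidD; apply: rapidZ; last exact: rapidB.
apply: rapidB => //; apply: rapidB; [exact: rapid_raise|exact: rapid_lower].
Qed.

Lemma hsnorm_sqr p f : 0 <= p -> schwartz f -> hsnorm p f ^+ 2 =
  energy (fun k => (2 * k + 1)%:R `^ (2%:R * p)) (hermite_coef f).
Proof.
move=> p0 sf; have q0 : 0 <= 2%:R * p by rewrite mulr_ge0.
have tw := odd_powR_tame q0.
have e : hsip p f f = energy (fun k => (2 * k + 1)%:R `^ (2%:R * p)) (hermite_coef f).
  by rewrite hsipE.
rewrite /hsnorm sqr_sqrtr ?e//; apply: energy_ge0 => //.
exact: rapid_hermite_coef.
Qed.

End Assembly.

Theorem theorem1p8 (R : realType) (alpha beta gamma delta : R) :
  let sigma : R -> R := fun x => alpha * x + beta in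
  let b : R -> R := fun x => gamma * x + delta in
  forall p : R, 0 <= p -> p \isn't a Num.int ->
  exists C : R, 0 < C /\
    forall phi : R -> R, schwartz phi ->
      2%:R * hsip p phi (Lstar sigma b phi) + hsnorm p (Astar sigma phi) ^+ 2
      <= C * hsnorm p phi ^+ 2.
Proof.
move=> sigma b p p0 _; have q0 : 0 <= 2%:R * p by rewrite mulr_ge0.
have tw := odd_powR_tame q0; set w := (fun k => _) in tw.
have [C hC] := dominated_monotone alpha beta gamma delta tw.
exists (`|C| + 1); split; first by rewrite ltr_wpDl.
move=> phi sphi; set c := hermite_coef phi.
have rc : rapid c by exact: rapid_hermite_coef.
have rA := rapid_seqA alpha beta rc.
have [rF leF] := hC c rc.
have tempw : tempered w by case: tw.
have rL : rapid (hermite_coef (Lstar sigma b phi)).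
  rewrite hermite_coef_Lstar//; apply: rapidD; last exact: rapid_seqA.
  by apply: rapidB; apply: rapidZ => //; exact: rapid_seqA.
rewrite !hsnorm_sqr//; last exact: schwartz_Astar.
rewrite hsipE -/w -series_sumZ; last first.
  by apply: rapidM_tempered => //; exact: rapidM.
rewrite /energy hermite_coef_Astar// -series_sumD; last 2 first.
- by apply: rapidZ; apply: rapidM_tempered => //; exact: rapidM.
- exact: rapid_weighted.
apply: (@le_trans _ _ (C * energy w c)); last first.
  by rewrite ler_wpM2r ?energy_ge0// (le_trans (ler_norm _))// lerDl.
apply: le_trans leF; apply: le_trans (ler_norm _).
rewrite le_eqVlt; apply/orP; left; apply/eqP; congr (limn (series _)).
apply/funext => k; by rewrite hermite_coef_Lstar// -/c -/(w k); ring.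
Qed.
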